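(* Let $\gamma>\gamma_{max}:=\max_{1\le i\le n_c}\gamma_i$, let $\mathbf h(\cdot,\cdot,\cdot)$ be the relaxation-based two-point numerical flux defined in the context for the multicomponent compressible Euler system, and consider, for a unit vector $\mathbf n\in\mathbb R^d$, the three-point scheme $$\mathbf U_j^{n+1}=\mathbf U_j^n-\frac{\Delta t}{\Delta x}\big(\mathbf h(\mathbf U_j^n,\mathbf U_{j+1}^n,\mathbf n)-\mathbf h(\mathbf U_{j-1}^n,\mathbf U_j^n,\mathbf n)\big),\qquad j\in\mathbb Z,$$ under the CFL condition $\frac{\Delta t}{\Delta x}\max_{j\in\mathbb Z}|\lambda(\mathbf U_j^n)|<\frac12$. Then: (i) $\mathbf h$ is consistent: $\mathbf h(\mathbf u,\mathbf u,\mathbf n)=\mathbf f(\mathbf u)\cdot\mathbf n$ for all $\mathbf u\in\Omega^a$; (ii) $\mathbf h$ is Lipschitz continuous (in its first two arguments); (iii) the scheme is entropy stable for the pair $(\eta,\mathbf q)=(-\rho\mathrm s,-\rho\mathrm s\mathbf v)$: $$\eta(\mathbf U_j^{n+1})-\eta(\mathbf U_j^n)+\frac{\Delta t}{\Delta x}\big(Q(\mathbf U_j^n,\mathbf U_{j+1}^n,\mathbf n)-Q(\mathbf U_{j-1}^n,\mathbf U_j^n,\mathbf n)\big)\le0\qquad\forall j\in\mathbb Z,$$ with the consistent entropy numerical flux $Q$ defined in the context ($Q(\mathbf u,\mathbf u,\mathbf n)=\mathbf q(\mathbf u)\cdot\mathbf n$); (iv) the flux $\mathbf h$ is entropy stable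 in the sense of Tadmor: $$\big(\boldsymbol\eta'(\mathbf u^+)-\boldsymbol\eta'(\mathbf u^-)\big)\cdot\mathbf h(\mathbf u^-,\mathbf u^+,\mathbf n)\le\big(\boldsymbol\psi(\mathbf u^+)-\boldsymbol\psi(\mathbf u^-)\big)\cdot\mathbf n\qquad\forall\mathbf u^\pm\in\Omega^a;$$ (v) the scheme is robust: $\mathbf U_j^n\in\Omega^a$ for all $j\in\mathbb Z$ and $n\ge0$, provided that $\mathbf U_j^{0}\in\Omega^a$ for all $j\in\mathbb Z$.
   Context: **Model.** Let $d\ge1$, $n_c\ge2$ components, constants $C_{v_i}>0$, $\gamma_i>1$, $C_{p_i}=\gamma_iC_{v_i}$, $r_i=C_{p_i}-C_{v_i}>0$, $\mathrm s_i^\infty\in\mathbb R$ ($1\le i\le n_c$). The unknown is $\mathbf u=(\rho\mathbf Y^\top,\rho,\rho\mathbf v^\top,\rho E)^\top\in\mathbb R^{n_c+d+1}$ with $\mathbf Y=(Y_1,\dots,Y_{n_c-1})^\top$, $Y_{n_c}=1-\sum_{i<n_c}Y_i$, $\mathbf v\in\mathbb R^d$, $e=E-\frac12\mathbf v\cdot\mathbf v$. Mixture laws: $C_p(\mathbf Y)=\sum_{i=1}^{n_c}Y_iC_{p_i}$, $C_v(\mathbf Y)=\sum_{i=1}^{n_c}Y_iC_{v_i}$, $r(\mathbf Y)=C_p(\mathbf Y)-C_v(\mathbf Y)$, $\gamma(\mathbf Y)=C_p(\mathbf Y)/C_v(\mathbf Y)$, temperature $\mathrm T=e/C_v(\mathbf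 Y)$, pressure $\mathrm p(\mathbf Y,\rho,e)=(\gamma(\mathbf Y)-1)\rho e$, $\theta=1/\mathrm T$, partial densities $\rho_i=\rho\,r(\mathbf Y)/r_i$. The system is $\partial_t\mathbf u+\nabla\cdot\mathbf f(\mathbf u)=0$ with $\mathbf f(\mathbf u)\cdot\mathbf n=\big(\rho\mathbf Y^\top\mathbf v\cdot\mathbf n,\ \rho\mathbf v\cdot\mathbf n,\ \rho(\mathbf v\cdot\mathbf n)\mathbf v^\top+\mathrm p\,\mathbf n^\top,\ (\rho E+\mathrm p)\mathbf v\cdot\mathbf n\big)^\top$. Admissible states: $\Omega^a=\{\mathbf u:\ 0\le Y_i\le1\ (1\le i\le n_c),\ \rho>0,\ e>0\}$. **Entropy.** $\mathrm s=\sum_{i=1}^{n_c}Y_i\mathrm s_i$ with $\mathrm s_i=-C_{v_i}\ln\theta-r_i\ln\rho_i+C_{v_i}\ln C_{v_i}+\mathrm s_i^\infty$; $\eta(\mathbf u)=-\rho\mathrm s$, $\mathbf q(\mathbf u)=-\rho\mathrm s\mathbf v$. Entropy variables (gradient of $\eta$): $\boldsymbol\eta'(\mathbf u)=\big((\mathrm s_{n_c}-\mathrm s_i+C_{p_i}-C_{p_{n_c}})_{1\le i<n_c},\ C_{p_{n_c}}-\mathrm s_{n_c}-\frac{\mathbf v\cdot\mathbf v}2\theta,\ \theta\mathbf v^\top,\ -\theta\big)^\top$. Entropy potential: $\boldsymbol\psi(\mathbf u)=\mathbf f(\mathbf u)^\top\boldsymbol\eta'(\mathbf u)-\mathbf q(\mathbf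 u)=r(\mathbf Y)\rho\mathbf v$. **Numerical flux.** Let $c_\gamma(\rho,\mathrm p)=\sqrt{\gamma\mathrm p/\rho}$, $(\cdot)^+=\max(\cdot,0)$. For $\mathbf u_L,\mathbf u_R\in\Omega^a$ and unit $\mathbf n$, put $u_X=\mathbf v_X\cdot\mathbf n$, $\mathrm p_X=\mathrm p(\mathbf Y_X,\rho_X,e_X)$, $\tau_X=1/\rho_X$ ($X=L,R$). Define $a_L,a_R$ by: if $\mathrm p_R\ge\mathrm p_L$, $\frac{a_L}{\rho_L}=c_\gamma(\rho_L,\mathrm p_L)+\frac{\gamma+1}2\big(\frac{\mathrm p_R-\mathrm p_L}{\rho_Rc_\gamma(\rho_R,\mathrm p_R)}+u_L-u_R\big)^+$ and then $\frac{a_R}{\rho_R}=c_\gamma(\rho_R,\mathrm p_R)+\frac{\gamma+1}2\big(\frac{\mathrm p_L-\mathrm p_R}{a_L}+u_L-u_R\big)^+$; otherwise $\frac{a_R}{\rho_R}=c_\gamma(\rho_R,\mathrm p_R)+\frac{\gamma+1}2\big(\frac{\mathrm p_L-\mathrm p_R}{\rho_Lc_\gamma(\rho_L,\mathrm p_L)}+u_L-u_R\big)^+$ and then $\frac{a_L}{\rho_L}=c_\gamma(\rho_L,\mathrm p_L)+\frac{\gamma+1}2\big(\frac{\mathrm p_R-\mathrm p_L}{a_R}+u_L-u_R\big)^+$. Set $S_L=u_L-a_L/\rho_L$, $S_R=u_R+a_R/\rho_R$, $u^\star=\frac{a_Lu_L+a_Ru_R+\mathrm p_L-\mathrm p_R}{a_L+a_R}$,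 $\mathrm p^\star=\frac{a_R\mathrm p_L+a_L\mathrm p_R+a_La_R(u_L-u_R)}{a_L+a_R}$, $\mathbf v_X^\star=\mathbf v_X+(u^\star-u_X)\mathbf n$, $1/\rho_L^\star=\tau_L+\frac{u^\star-u_L}{a_L}$, $1/\rho_R^\star=\tau_R+\frac{u_R-u^\star}{a_R}$, $E_L^\star=E_L-\frac{\mathrm p^\star u^\star-\mathrm p_Lu_L}{a_L}$, $E_R^\star=E_R-\frac{\mathrm p_Ru_R-\mathrm p^\star u^\star}{a_R}$, and $\mathbf u_X^\star=(\rho_X^\star\mathbf Y_X^\top,\rho_X^\star,\rho_X^\star\mathbf v_X^{\star\top},\rho_X^\star E_X^\star)^\top$. The approximate Riemann solver is $$\mathcal W^r(\tfrac xt;\mathbf u_L,\mathbf u_R,\mathbf n)=\begin{cases}\mathbf u_L,&\tfrac xt<S_L,\\ \mathbf u_L^\star,&S_L<\tfrac xt<u^\star,\\ \mathbf u_R^\star,&u^\star<\tfrac xt<S_R,\\ \mathbf u_R,&S_R<\tfrac xt,\end{cases}$$ and the flux is $\mathbf h(\mathbf u^-,\mathbf u^+,\mathbf n)=\mathbf f\big(\mathcal W^r(0;\mathbf u^-,\mathbf u^+,\mathbf n)\big)\cdot\mathbf n$. **Entropy numerical flux.** Let $h_\rho$ denote the $\rho$-component of $\mathbf h(\mathbf u_L,\mathbf u_R,\mathbf n)$. Then $Q(\mathbf u_L,\mathbf u_R,\mathbf n)=-h_\rho\,\mathrm s(\mathbf u_L)$ if $u^\star\ge0$ and $Q(\mathbf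 u_L,\mathbf u_R,\mathbf n)=-h_\rho\,\mathrm s(\mathbf u_R)$ if $u^\star<0$ (the specific entropy is transported by the contact wave in the underlying relaxation Riemann solution). **Wave speeds in the CFL condition.** $|\lambda(\mathbf u)|=|\mathbf v\cdot\mathbf n|+a/\rho$ with $a$ the Lagrangian sound speed ($a_L$ or $a_R$) above; for $\mathbf U_j^n$ it is taken over the pairs $(\mathbf U_{j-1}^n,\mathbf U_j^n)$ and $(\mathbf U_j^n,\mathbf U_{j+1}^n)$. $\Delta t,\Delta x>0$.
   Formalization: When W^r(0) is an intermediate state u*_L or u*_R, the flux h uses the pressure p* in f instead of the equation-of-state pressure p(Y,ρ,e), and ''Lipschitz continuous'' in (ii) means locally Lipschitz on Ω^a×Ω^a; read literally, (ii) is false. *)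

(* Defs.v *)
(* MathComp / MathComp-Analysis *)
From HB Require Import structures.
From mathcomp Require Export all_boot all_order all_algebra.
From mathcomp Require Export all_classical all_reals all_analysis.
Export Order.TTheory GRing.Theory Num.Theory.
Export numFieldNormedType.Exports.

Set Implicit Arguments.
Unset Strict Implicit.
Unset Printing Implicit Defensive.

Local Open Scope classical_set_scope.
Local Open Scope ring_scope.

(* A mixture of n_c = m.+1 components in d space dimensions. A state is
   u = (rho Y, rho, rho v, rho E), where Y lists the mass fractions of the
   first m components; the last component has index [ord_max] in 'I_m.+1. *)
Notation state R m d := 'rV[R]_(m + (1 + (d + 1))).

Record mixture (R : realType) (m : nat) := Mixture {
  Cv : 'I_m.+1 -> R;
  gam : 'I_m.+1 -> R;
  sinf : 'I_m.+1 -> R }.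

Definition dotv (R : realType) (k : nat) (x y : 'rV[R]_k) : R :=
  \sum_i x 0 i * y 0 i.

Section Model.
Context {R : realType} {m d : nat} (M : mixture R m).
Implicit Types (u uL uR w : state R m d) (n : 'rV[R]_d) (Y : 'rV[R]_m).

Definition mkvec Y (r : R) (q : 'rV[R]_d) (E : R) : state R m d :=
  row_mx Y (row_mx r%:M (row_mx q E%:M)).

Definition rhoY u : 'rV[R]_m := lsubmx u.
Definition rho u : R := lsubmx (rsubmx u) 0 0.
Definition rhov u : 'rV[R]_d := lsubmx (rsubmx (rsubmx u)).
Definition rhoE u : R := rsubmx (rsubmx (rsubmx u)) 0 0.

Definition fracs u : 'rV[R]_m := (rho u)^-1 *: rhoY u.
Definition vel u : 'rV[R]_d := (rho u)^-1 *: rhov u.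
Definition Etot u : R := rhoE u / rho u.
Definition eint u : R := Etot u - dotv (vel u) (vel u) / 2.
Definition un n u : R := dotv (vel u) n.

Definition massfrac Y (i : 'I_m.+1) : R :=
  if unlift ord_max i is Some j then Y 0 j else 1 - \sum_j Y 0 j.

Definition Cp i : R := gam M i * Cv M i.
Definition rgas i : R := Cp i - Cv M i.
Definition gam_max : R := \big[Num.max/gam M ord0]_(i < m.+1) gam M i.

Definition Cpmix Y : R := \sum_i massfrac Y i * Cp i.
Definition Cvmix Y : R := \sum_i massfrac Y i * Cv M i.
Definition rmix Y : R := Cpmix Y - Cvmix Y.
Definition gammix Y : R := Cpmix Y / Cvmix Y.

Definition temp u : R := eint u / Cvmix (fracs u).
Definition theta u : R := (temp u)^-1.
Definition pressure Y (r e : R) : R := (gammix Y - 1) * r * e.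
Definition pres u : R := pressure (fracs u) (rho u) (eint u).
Definition partial_rho i u : R := rho u * rmix (fracs u) / rgas i.

Definition Omega_a : set (state R m d) :=
  [set u | [/\ forall i, 0 <= massfrac (fracs u) i <= 1,
               0 < rho u & 0 < eint u]].

(* Normal flux of the state u when the pressure is pi; the flux f(u).n of the
   Euler system is the case of the equilibrium pressure pi = p(Y, rho, e). *)
Definition flux_with_pressure (pi : R) u n : state R m d :=
  mkvec (un n u *: rhoY u)
        (rho u * un n u)
        ((rho u * un n u) *: vel u + pi *: n)
        ((rhoE u + pi) * un n u).
Definition flux u n : state R m d := flux_with_pressure (pres u) u n.

Definition s_part i u : R :=
  - Cv M i * ln (theta u) - rgas i * ln (partial_rho i u)
  + Cv M i * ln (Cv M i) + sinf M i.
Definition entropy_s u : R := \sum_i massfrac (fracs u) i * s_part i u.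
Definition eta u : R := - rho u * entropy_s u.
Definition entropy_flux u : 'rV[R]_d := (- rho u * entropy_s u) *: vel u.

(* The entropy variables eta'(u); [lift ord_max i] is component i < n_c. *)
Definition eta' u : state R m d :=
  mkvec (\row_(i < m) (s_part ord_max u - s_part (lift ord_max i) u
                       + Cp (lift ord_max i) - Cp ord_max))
        (Cp ord_max - s_part ord_max u
         - dotv (vel u) (vel u) / 2 * theta u)
        (theta u *: vel u)
        (- theta u).

(* psi(u) = f(u)^T eta'(u) - q(u); the k-th column of f(u) is f(u).e_k. *)
Definition psi u : 'rV[R]_d :=
  \row_k dotv (flux u (delta_mx 0 k)) (eta' u) - entropy_flux u.

Section Riemann.
Variable gamma : R.

Definition c_gamma (r p : R) : R := Num.sqrt (gamma * p / r).
Definition pos (x : R) : R := Num.max x 0.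

(* Lagrangian sound speeds (a_L, a_R). *)
Definition lagrangian_speeds n uL uR : R * R :=
  let alpha := (gamma + 1) / 2 in
  let: (rL, pL, vL) := (rho uL, pres uL, un n uL) in
  let: (rR, pR, vR) := (rho uR, pres uR, un n uR) in
  let cL := c_gamma rL pL in
  let cR := c_gamma rR pR in
  if pL <= pR then
    let aL := rL * (cL + alpha * pos ((pR - pL) / (rR * cR) + vL - vR)) in
    let aR := rR * (cR + alpha * pos ((pL - pR) / aL + vL - vR)) in
    (aL, aR)
  else
    let aR := rR * (cR + alpha * pos ((pL - pR) / (rL * cL) + vL - vR)) in
    let aL := rL * (cL + alpha * pos ((pR - pL) / aR + vL - vR)) in
    (aL, aR).
Definition aL n uL uR : R := (lagrangian_speeds n uL uR).1.
Definition aR n uL uR : R := (lagrangian_speeds n uL uR).2.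

Definition SL n uL uR : R := un n uL - aL n uL uR / rho uL.
Definition SR n uL uR : R := un n uR + aR n uL uR / rho uR.

Definition ustar n uL uR : R :=
  let: (a, b) := (aL n uL uR, aR n uL uR) in
  (a * un n uL + b * un n uR + pres uL - pres uR) / (a + b).
Definition pstar n uL uR : R :=
  let: (a, b) := (aL n uL uR, aR n uL uR) in
  (b * pres uL + a * pres uR + a * b * (un n uL - un n uR)) / (a + b).

Definition rhoLstar n uL uR : R :=
  ((rho uL)^-1 + (ustar n uL uR - un n uL) / aL n uL uR)^-1.
Definition rhoRstar n uL uR : R :=
  ((rho uR)^-1 + (un n uR - ustar n uL uR) / aR n uL uR)^-1.
Definition ELstar n uL uR : R :=
  Etot uL - (pstar n uL uR * ustar n uL uR - pres uL * un n uL) / aL n uL uR.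
Definition ERstar n uL uR : R :=
  Etot uR - (pres uR * un n uR - pstar n uL uR * ustar n uL uR) / aR n uL uR.

Definition uLstar n uL uR : state R m d :=
  let r := rhoLstar n uL uR in
  mkvec (r *: fracs uL) r
        (r *: (vel uL + (ustar n uL uR - un n uL) *: n)) (r * ELstar n uL uR).
Definition uRstar n uL uR : state R m d :=
  let r := rhoRstar n uL uR in
  mkvec (r *: fracs uR) r
        (r *: (vel uR + (ustar n uL uR - un n uR) *: n)) (r * ERstar n uL uR).

(* The Riemann solver W^r(xi; uL, uR, n), together with the pressure carried
   by the relaxation solution. In the star region this pressure is p*, which
   in general differs from the equilibrium pressure [pres] of u*_L and u*_R:
   the Rankine-Hugoniot relations S_L (u*_L - u_L) = F*_L - f(u_L).n and
   S_R (u_R - u*_R) = f(u_R).n - F*_R hold for the fluxes F* taken with p*, and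
   fail for [flux]. On the jumps themselves W^r takes its left value; this
   choice does not affect [num_flux], which is continuous across them. *)
Definition riemann (xi : R) n uL uR : state R m d * R :=
  if xi <= SL n uL uR then (uL, pres uL)
  else if xi <= ustar n uL uR then (uLstar n uL uR, pstar n uL uR)
  else if xi <= SR n uL uR then (uRstar n uL uR, pstar n uL uR)
  else (uR, pres uR).

(* h(uL, uR, n) = f(W^r(0; uL, uR, n)).n *)
Definition num_flux uL uR n : state R m d :=
  let: (w, pi) := riemann 0 n uL uR in flux_with_pressure pi w n.

Definition num_entropy_flux uL uR n : R :=
  let h_rho := rho (num_flux uL uR n) in
  if 0 <= ustar n uL uR then - h_rho * entropy_s uL
  else - h_rho * entropy_s uR.

Section Scheme.
Variables (dt dx : R) (n : 'rV[R]_d).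
Implicit Types (U : int -> state R m d) (j : int).

Definition scheme_step U j : state R m d :=
  U j - (dt / dx) *: (num_flux (U j) (U (j + 1)) n
                      - num_flux (U (j - 1)) (U j) n).

(* U_j is the right state of the pair (U_{j-1}, U_j) and the left state of
   the pair (U_j, U_{j+1}). *)
Definition wave_speed U j : R :=
  Num.max (`|un n (U j)| + aR n (U (j - 1)) (U j) / rho (U j))
          (`|un n (U j)| + aL n (U j) (U (j + 1)) / rho (U j)).

Definition CFL U : Prop :=
  ((dt / dx)%:E * ereal_sup [set (wave_speed U j)%:E | j in [set: int]]
     < (2^-1)%:E)%E.

End Scheme.
End Riemann.
End Model.

(* Main.v *)
(* Across each acoustic wave of the relaxation solution the specific volume and
   the internal energy satisfy e* = e - p (tau* - tau) + a^2 (tau* - tau)^2 / 2.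
   The Lagrangian speeds are chosen so large that e* exceeds its value on the
   isentrope through the adjacent state; hence the star states are admissible
   and carry at least the entropy of that state. Since the jump relations hold
   with the relaxation pressure, h has the case-free expression
     h = f(uL) + S_L^- (u*_L - uL) + u*^- (u*_R - u*_L) + S_R^- (uR - u*_R),
   with x^- = min(x, 0), and symmetrically from uR with positive parts. Thus
   f(uL) - h and h - f(uR) are nonnegative combinations of differences
   w - u of admissible states (an "entropy fan"). Under the CFL condition the
   updated state is a convex combination of admissible states, and the convexity
   of eta, in the form eta(w) >= eta(u) + eta'(u) (w - u), yields robustness, the
   discrete entropy inequality and Tadmor's inequality. The case-free expression
   is also what makes h locally Lipschitz. *)
From mathcomp Require Import ring lra.
Require Import Defs.

Set Implicit Arguments.
Unset Strict Implicit.
Unset Printing Implicit Defensive.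

Local Open Scope classical_set_scope.
Local Open Scope ring_scope.

(** * Real inequalities behind the subcharacteristic condition *)

Section ScalarInequalities.
Context {R : realType}.
Implicit Types x y t k p A : R.

Lemma ln_le_subr1 x : 0 < x -> ln x <= x - 1.
Proof.
move=> x0; have -> : ln x = ln (1 + (x - 1)) by congr ln; ring.
by apply: le_ln1Dx; lra.
Qed.

(** Combines [exp x >= 1 + x] with [ln x <= x - 1] at [x = t^-1]. This bound and the next one
    replace convexity arguments for powers: the bound in [t^-1] serves below 1, the bound in [t - 1]
    above 1. *)
Lemma powR_ge_tangent p t : 0 <= p -> 0 < t -> 1 + p * (1 - t^-1) <= t `^ p.
Proof.
move=> p0 t0; have tV0 : 0 < t^-1 by rewrite invr_gt0.
have := ln_le_subr1 tV0; rewrite lnV ?posrE// => tl.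
rewrite -[leRHS]lnK ?posrE ?powR_gt0// ln_powR.
apply: le_trans (expR_ge1Dx _).
by rewrite lerD2l ler_wpM2l//; lra.
Qed.

Lemma powR_ge_tangentN p t : 0 <= p -> 0 < t -> 1 - p * (t - 1) <= t `^ (- p).
Proof.
move=> p0 t0; have tl := ln_le_subr1 t0.
rewrite -[leRHS]lnK ?posrE ?powR_gt0// ln_powR.
apply: le_trans (expR_ge1Dx _).
by rewrite lerD2l mulNr lerN2 ler_wpM2l.
Qed.

(** Right side minus left side of [powR_le_quadratic], up to the additive constant [1 + k]. *)
Let gap k A t := A / 2 * (t - 1) ^+ 2 - k * t - t `^ (- k).

Let is_derive_gap k A x : 0 < x ->
  is_derive x (1 : R) (gap k A) (A * (x - 1) - k + k * x `^ (- k - 1)).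
Proof.
move=> x0; have pD := is_derive1_powR (- k) x0.
rewrite /gap; apply: is_derive_eq.
by rewrite /GRing.scale /=; field.
Qed.

Let gap_MVT k A a b : 0 < a -> a <= b ->
  exists2 c, c \in `[a, b]%R &
    gap k A b - gap k A a = (A * (c - 1) - k + k * c `^ (- k - 1)) * (b - a).
Proof.
move=> a0 ab; apply: (@MVT_segment _ (gap k A)
  (fun c => A * (c - 1) - k + k * c `^ (- k - 1)) a b ab).
- by move=> x xab; apply: is_derive_gap; rewrite (lt_trans a0)// (itvP xab).
- apply: derivable_within_continuous => x xab.
  have x0 : 0 < x by rewrite (lt_le_trans a0)// (itvP xab).
  exact: (@ex_derive _ _ _ _ _ _ _ (is_derive_gap k A x0)).
Qed.

(** The difference of the two sides vanishes at 1 together with its derivative. Its second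
    derivative is [A - k (k + 1) c^(- k - 2)], and the conditions on [A] make this nonnegative at 1
    and at [t], hence in between. The proof stays with the first derivative and shows that it has
    the sign of [c - 1]. *)
Lemma powR_le_quadratic k A t : 0 < k -> 0 < t ->
  k * (k + 1) <= A -> k * (k + 1) <= A * t `^ (k + 2) ->
  t `^ (- k) <= 1 - k * (t - 1) + A / 2 * (t - 1) ^+ 2.
Proof.
move=> k0 t0 A1 At.
have A0 : 0 <= A by apply: le_trans A1; rewrite mulr_ge0//; lra.
suff : gap k A 1 <= gap k A t by rewrite /gap powR1; lra.
have [t1|t1] := leP 1 t.
- have [c cab] := gap_MVT k A ltr01 t1.
  rewrite -subr_ge0 => ->; apply: mulr_ge0; last by lra.
  have c1 : 1 <= c by rewrite (itvP cab).
  have p0 : 0 <= k + 1 by lra.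
  have := powR_ge_tangentN p0 (lt_le_trans ltr01 c1); rewrite opprD => ck.
  have : k * (1 - (k + 1) * (c - 1)) <= k * c `^ (- k - 1) by rewrite ler_pM2l.
  have : k * (k + 1) * (c - 1) <= A * (c - 1) by rewrite ler_wpM2r//; lra.
  lra.
- have [c cab] := gap_MVT k A t0 (ltW t1).
  move=> gapE; rewrite -subr_le0 gapE; apply: mulr_le0_ge0; last by lra.
  have c0 : 0 < c by rewrite (lt_le_trans t0)// (itvP cab).
  have c1 : c <= 1 by rewrite (itvP cab).
  (* As [t <= c], the condition at [t] passes to the mean value point [c]. *)
  have tc : t `^ (k + 2) <= c `^ (k + 2).
    by apply: ge0_ler_powR; rewrite ?nnegrE ?(itvP cab)//; lra.
  have Ac : k * (k + 1) <= A * c `^ (k + 2).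
    by apply: le_trans At _; rewrite ler_wpM2l.
  have p0 : 0 <= k + 1 by lra.
  have ck := powR_ge_tangent p0 c0.
  have pM (u v : R) : c `^ u * c `^ v = c `^ (u + v).
    by rewrite powRD// (gt_eqF c0) implybT.
  have cE : c = c `^ 1 by rewrite powRr1// ltW.
  have d0 : 0 < c `^ (- k - 2) by rewrite powR_gt0.
  have e1 : c `^ (k + 2) * c `^ (- k - 2) = 1.
    by rewrite pM (_ : _ + _ = 0) ?powRr0//; ring.
  have e4 : c `^ (- k - 1) = c * c `^ (- k - 2).
    by rewrite {2}cE pM; congr (_ `^ _); ring.
  have e5 : c `^ (k + 1) * c `^ (- k - 1) = 1.
    by rewrite pM (_ : _ + _ = 0) ?powRr0//; ring.
  have A2 : k * (k + 1) * c `^ (- k - 2) <= A.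
    by have := ler_wpM2r (ltW d0) Ac; rewrite -[leRHS]mulrA e1 mulr1.
  (* The tangent bound for [c^(k + 1)], multiplied by [c^(- k - 1)]. *)
  have T : c `^ (- k - 1) + (k + 1) * (c - 1) * c `^ (- k - 2) <= 1.
    have /(ler_wpM2r (powR_ge0 c (- k - 1))) := ck; rewrite e5 e4.
    congr (_ <= _); field; exact: lt0r_neq0.
  have A3 : k * (k + 1) * c `^ (- k - 2) * (1 - c) <= A * (1 - c).
    by rewrite ler_wpM2r//; lra.
  have : k * (c `^ (- k - 1) + (k + 1) * (c - 1) * c `^ (- k - 2)) <= k * 1.
    by rewrite ler_pM2l.
  lra.
Qed.

(* Concavity of ln: [1 + (al - 1) y] is the mean of [1] and [1 + al y] with
   weights [1 / al] and [(al - 1) / al]. *)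
Lemma mul_ln1D_le (al y : R) : 1 < al -> 0 <= y ->
  (al - 1) * ln (1 + al * y) <= al * ln (1 + (al - 1) * y).
Proof.
move=> al1 y0.
have p0 : 0 < 1 + al * y by apply: ltr_pwDl => //; apply: mulr_ge0 => //; lra.
have q0 : 0 < 1 + (al - 1) * y.
  by apply: ltr_pwDl => //; apply: mulr_ge0 => //; lra.
set q := 1 + (al - 1) * y in q0 *; set p := 1 + al * y in p0 *.
(* [ln x <= x - 1] is used at [q^-1] with weight 1 and at [p / q] with weight [al - 1]; the weighted
   right-hand sides cancel. *)
have qV0 : 0 < q^-1 by rewrite invr_gt0.
have pq0 : 0 < p / q by rewrite divr_gt0.
have := ln_le_subr1 qV0; rewrite lnV ?posrE// => h1.
have := ln_le_subr1 pq0; rewrite ln_div ?posrE// => h2.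
have h3 : (al - 1) * (ln p - ln q) <= (al - 1) * (p / q - 1).
  by rewrite ler_wpM2l//; lra.
have h4 : q^-1 - 1 + (al - 1) * (p / q - 1) = 0.
  by rewrite /p /q; field; exact: lt0r_neq0.
lra.
Qed.

(* With t = tau* / tau, k = gamma(Y) - 1 and y = X / c, where a = rho (c + al X),
   the right-hand side is e* / e and the left-hand side is its value along the
   isentrope: across the acoustic wave the entropy does not decrease. *)
Lemma powR_le_subcharacteristic k ga y t : 0 < k -> k + 1 <= ga -> 0 <= y ->
  let al := (ga + 1) / 2 in
  (1 + (al - 1) * y) / (1 + al * y) <= t ->
  t `^ (- k) <=
    1 - k * (t - 1) + (ga * k * (1 + al * y) ^+ 2) / 2 * (t - 1) ^+ 2.
Proof.
move=> k0 kga y0 al t0t.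
have al1 : 1 < al by rewrite /al; lra.
have aly : 0 <= al * y by rewrite mulr_ge0//; lra.
have aly' : 0 <= (al - 1) * y by rewrite mulr_ge0//; lra.
have p0 : 0 < 1 + al * y by lra.
have q0 : 0 < 1 + (al - 1) * y by lra.
have t0 : 0 < t by apply: lt_le_trans t0t; rewrite divr_gt0.
have gak : k * (k + 1) <= ga * k by rewrite mulrC ler_wpM2r// ltW.
have gak0 : 0 <= ga * k by rewrite mulr_ge0//; lra.
have gakA : ga * k <= ga * k * (1 + al * y) ^+ 2.
  by apply: ler_peMr => //; apply: exprn_ege1; lra.
apply: powR_le_quadratic => //; first exact: le_trans gakA.
(* The condition at [t] remains. For [t >= 1] the power of [t] only helps; in compression the factor
   [(1 + al y)^2] has to make up for [t^(k + 2)]. *)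
have [t1|t1] := leP 1 t.
  have t1' : 1 <= t `^ (k + 2).
    by rewrite -[leLHS](powRr0 t) ler_powR//; lra.
  apply: le_trans (le_trans gak gakA) _.
  by apply: ler_peMr => //; rewrite mulr_ge0// sqr_ge0.
apply: le_trans gak _; rewrite -[leRHS]mulrA; apply: ler_peMr => //.
have -> : (1 + al * y) ^+ 2 = (1 + al * y) `^ 2 by rewrite powR_mulrn// ltW.
(* Since [k + 2 <= ga + 1 = 2 al] and [t < 1], the exponent may be raised to [2 al]; logarithms then
   turn the claim into [mul_ln1D_le]. *)
have : 1 <= (1 + al * y) `^ 2 * t `^ (2 * al).
  rewrite -[leRHS]lnK ?posrE ?mulr_gt0 ?powR_gt0// -[leLHS]expR0 ler_expR.
  rewrite lnM ?posrE ?powR_gt0// !ln_powR.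
  have : ln ((1 + (al - 1) * y) / (1 + al * y)) <= ln t.
    by rewrite ler_ln// posrE ?divr_gt0.
  rewrite ln_div ?posrE// => /(ler_wpM2l (ltW (lt_trans ltr01 al1))).
  by have := mul_ln1D_le al1 y0; lra.
move/le_trans; apply; rewrite ler_wpM2l ?powR_ge0//.
by apply: ger_powR; [rewrite t0 ltW|rewrite /al; lra].
Qed.

End ScalarInequalities.

(** * Conserved variables and admissible states *)

Section DotProduct.
Context {R : realType} {k : nat}.
Implicit Types x y z : 'rV[R]_k.

Lemma dotvC x y : dotv x y = dotv y x.
Proof. by apply: eq_bigr => i _; rewrite mulrC. Qed.

Lemma dotvDl x y z : dotv (x + y) z = dotv x z + dotv y z.
Proof. by rewrite -big_split; apply: eq_bigr => i _; rewrite mxE mulrDl. Qed.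

Lemma dotvZl (a : R) x z : dotv (a *: x) z = a * dotv x z.
Proof. by rewrite mulr_sumr; apply: eq_bigr => i _; rewrite mxE mulrA. Qed.

Lemma dotvNl x z : dotv (- x) z = - dotv x z.
Proof. by rewrite -scaleN1r dotvZl mulN1r. Qed.

Lemma dotvBl x y z : dotv (x - y) z = dotv x z - dotv y z.
Proof. by rewrite dotvDl dotvNl. Qed.

Lemma dotvDr x y z : dotv x (y + z) = dotv x y + dotv x z.
Proof. by rewrite !(dotvC x) dotvDl. Qed.

Lemma dotvZr (a : R) x z : dotv x (a *: z) = a * dotv x z.
Proof. by rewrite !(dotvC x) dotvZl. Qed.

Lemma dotvBr x y z : dotv x (y - z) = dotv x y - dotv x z.
Proof. by rewrite !(dotvC x) dotvBl. Qed.

Lemma dotv0l z : dotv 0 z = 0.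
Proof. by rewrite -(scale0r 0) dotvZl mul0r. Qed.

Lemma dotvv_ge0 x : 0 <= dotv x x.
Proof. by apply: sumr_ge0 => i _; rewrite -expr2 sqr_ge0. Qed.

End DotProduct.

Section StateAlgebra.
Context {R : realType} {m d : nat}.
Implicit Types (u w : state R m d) (Y : 'rV[R]_m) (q : 'rV[R]_d) (a r E : R).

Lemma rhoY_mkvec Y r q E : rhoY (mkvec Y r q E) = Y.
Proof. exact: row_mxKl. Qed.

Lemma rho_mkvec Y r q E : rho (mkvec Y r q E) = r.
Proof. by rewrite /rho row_mxKr row_mxKl mxE mulr1n. Qed.

Lemma rhov_mkvec Y r q E : rhov (mkvec Y r q E) = q.
Proof. by rewrite /rhov !row_mxKr row_mxKl. Qed.

Lemma rhoE_mkvec Y r q E : rhoE (mkvec Y r q E) = E.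
Proof. by rewrite /rhoE !row_mxKr mxE mulr1n. Qed.

Definition mkvecK := (rhoY_mkvec, rho_mkvec, rhov_mkvec, rhoE_mkvec).

Lemma rhoYD u w : rhoY (u + w) = rhoY u + rhoY w.
Proof. by apply/rowP => i; rewrite !mxE. Qed.
Lemma rhoYZ a u : rhoY (a *: u) = a *: rhoY u.
Proof. by apply/rowP => i; rewrite !mxE. Qed.
Lemma rhoYB u w : rhoY (u - w) = rhoY u - rhoY w.
Proof. by apply/rowP => i; rewrite !mxE. Qed.

Lemma rhoD u w : rho (u + w) = rho u + rho w.
Proof. by rewrite /rho !mxE. Qed.
Lemma rhoZ a u : rho (a *: u) = a * rho u.
Proof. by rewrite /rho !mxE. Qed.
Lemma rhoB u w : rho (u - w) = rho u - rho w.
Proof. by rewrite /rho !mxE. Qed.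

Lemma rhovD u w : rhov (u + w) = rhov u + rhov w.
Proof. by apply/rowP => i; rewrite !mxE. Qed.
Lemma rhovZ a u : rhov (a *: u) = a *: rhov u.
Proof. by apply/rowP => i; rewrite !mxE. Qed.
Lemma rhovB u w : rhov (u - w) = rhov u - rhov w.
Proof. by apply/rowP => i; rewrite !mxE. Qed.

Lemma rhoED u w : rhoE (u + w) = rhoE u + rhoE w.
Proof. by rewrite /rhoE !mxE. Qed.
Lemma rhoEZ a u : rhoE (a *: u) = a * rhoE u.
Proof. by rewrite /rhoE !mxE. Qed.
Lemma rhoEB u w : rhoE (u - w) = rhoE u - rhoE w.
Proof. by rewrite /rhoE !mxE. Qed.

Definition stateD := (rhoYD, rhoD, rhovD, rhoED).
Definition stateZ := (rhoYZ, rhoZ, rhovZ, rhoEZ).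
Definition stateB := (rhoYB, rhoB, rhovB, rhoEB).

Lemma mkvec_eta u : u = mkvec (rhoY u) (rho u) (rhov u) (rhoE u).
Proof.
by rewrite /mkvec /rho /rhoE -!mx11_scalar !hsubmxK.
Qed.

Lemma state_ext u w : rhoY u = rhoY w -> rho u = rho w -> rhov u = rhov w ->
  rhoE u = rhoE w -> u = w.
Proof. by rewrite [u in u = w]mkvec_eta => -> -> -> ->; rewrite -mkvec_eta. Qed.

Lemma dotv_state u w : dotv u w =
  dotv (rhoY u) (rhoY w) + rho u * rho w + dotv (rhov u) (rhov w)
  + rhoE u * rhoE w.
Proof.
rewrite /dotv !big_split_ord /= !big_ord1 !addrA.
congr (_ + _ + _ + _).
- by apply: eq_bigr => i _; rewrite !mxE.
- by rewrite /rho !mxE.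
- by apply: eq_bigr => i _; rewrite !mxE.
- by rewrite /rhoE !mxE.
Qed.

Lemma rho_vel u : rho u != 0 -> rhov u = rho u *: vel u.
Proof. by move=> r0; rewrite /vel scalerA divff// scale1r. Qed.

Lemma rho_fracs u : rho u != 0 -> rhoY u = rho u *: fracs u.
Proof. by move=> r0; rewrite /fracs scalerA divff// scale1r. Qed.

Lemma rho_Etot u : rho u != 0 -> rhoE u = rho u * Etot u.
Proof. by move=> r0; rewrite /Etot mulrC divfK. Qed.

End StateAlgebra.

Section MassFractions.
Context {R : realType} {m : nat}.
Implicit Types Y : 'rV[R]_m.

Lemma massfrac_lift Y i : massfrac Y (lift ord_max i) = Y 0 i.
Proof. by rewrite /massfrac liftK. Qed.

Lemma massfrac_last Y : massfrac Y ord_max = 1 - \sum_j Y 0 j.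
Proof. by rewrite /massfrac unlift_none. Qed.

Lemma sum_massfrac Y : \sum_i massfrac Y i = 1.
Proof.
rewrite (bigD1_ord ord_max)//= massfrac_last.
by under eq_bigr do rewrite massfrac_lift; rewrite subrK.
Qed.

Lemma massfrac_mean_gt0 Y (c : 'I_m.+1 -> R) : (forall i, 0 <= massfrac Y i) ->
  (forall i, 0 < c i) -> 0 < \sum_i massfrac Y i * c i.
Proof.
move=> Y0 c0; rewrite lt_neqAle sumr_ge0 ?andbT; last first.
  by move=> i _; rewrite mulr_ge0// ltW.
apply/eqP => /esym/psumr_eq0P S0.
have := sum_massfrac Y.
rewrite big1 => [/eqP|i _]; first by rewrite eq_sym oner_eq0.
have /eqP : massfrac Y i * c i = 0.
  by apply: S0 => // j _; rewrite mulr_ge0// ltW.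
by rewrite mulf_eq0 (gt_eqF (c0 i)) orbF => /eqP.
Qed.

End MassFractions.

(** * Admissibility as a family of linear conditions *)

Section AdmissibleCone.
Context {R : realType} {m d : nat}.
Implicit Types (u w : state R m d) (z : 'rV[R]_d).

(** The partial mass [rho Y_i], written without division by [rho] so that it is linear in the
    state. *)
Definition pmass u (i : 'I_m.+1) : R :=
  if unlift ord_max i is Some j then rhoY u 0 j
  else rho u - \sum_j rhoY u 0 j.

Lemma pmassE u i : rho u != 0 -> pmass u i = rho u * massfrac (fracs u) i.
Proof.
move=> r0; rewrite /pmass /massfrac.
case: unliftP => [j _|_].
  by rewrite [in LHS]rho_fracs// mxE.
rewrite mulrBr mulr1 mulr_sumr; congr (_ - _).
by apply: eq_bigr => j _; rewrite [in LHS]rho_fracs// mxE.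
Qed.

Lemma pmassD u w i : pmass (u + w) i = pmass u i + pmass w i.
Proof.
rewrite /pmass; case: unliftP => [j _|_]; first by rewrite rhoYD mxE.
rewrite rhoD rhoYD; under eq_bigr do rewrite mxE.
by rewrite big_split /=; ring.
Qed.

Lemma pmassZ (a : R) u i : pmass (a *: u) i = a * pmass u i.
Proof.
rewrite /pmass; case: unliftP => [j _|_]; first by rewrite rhoYZ mxE.
rewrite rhoZ rhoYZ; under eq_bigr do rewrite mxE.
by rewrite -mulr_sumr; ring.
Qed.

(** Total energy per unit volume in the frame moving with velocity [z]; for fixed [z] it is linear
    in [u]. *)
Definition energy_at z u : R :=
  rhoE u - dotv (rhov u) z + rho u * (dotv z z / 2).

Lemma energy_atE z u : rho u != 0 ->
  energy_at z u = rho u * (eint u + dotv (vel u - z) (vel u - z) / 2).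
Proof.
move=> r0; rewrite /energy_at /eint {1}rho_vel// {1}rho_Etot//.
rewrite dotvZl !dotvBl !dotvBr (dotvC z); by field.
Qed.

(* The internal energy is not linear in the conserved variables, but its
   positivity amounts to that of the total energy in every Galilean frame. *)
Lemma Omega_aP u : Omega_a u <->
  [/\ 0 < rho u, forall i, 0 <= pmass u i & forall z, 0 < energy_at z u].
Proof.
split=> [[Y01 r0 e0]|[r0 p0 E0]].
  have rn0 := lt0r_neq0 r0; split => // [i|z].
    by rewrite pmassE// mulr_ge0 ?(ltW r0)//; case/andP: (Y01 i).
  by rewrite energy_atE// mulr_gt0// ltr_pwDl// divr_ge0// dotvv_ge0.
have rn0 := lt0r_neq0 r0.
have Y0 i : 0 <= massfrac (fracs u) i.
  by have := p0 i; rewrite pmassE// pmulr_rge0.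
split => //.
  move=> i; rewrite Y0 /= -(sum_massfrac (fracs u)) (bigD1 i)//= lerDl.
  by rewrite sumr_ge0.
have := E0 (vel u); rewrite energy_atE// pmulr_rgt0// subrr.
by rewrite dotv0l mul0r addr0.
Qed.

Lemma Omega_a_scale (a : R) u : 0 < a -> Omega_a u -> Omega_a (a *: u).
Proof.
move=> a0 /Omega_aP[r0 p0 E0]; apply/Omega_aP; split=> [|i|z].
- by rewrite rhoZ mulr_gt0.
- by rewrite pmassZ mulr_ge0// ltW.
- rewrite /energy_at !stateZ dotvZl -mulrA -mulrBr -mulrDr.
  exact: mulr_gt0 a0 (E0 z).
Qed.

(** The conditions of [Omega_aP] are linear, so admissible states form a convex cone. The weight [a]
    may vanish, as the weights of a fan often do. *)
Lemma Omega_a_add (a : R) u w : Omega_a u -> Omega_a w -> 0 <= a ->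
  Omega_a (u + a *: w).
Proof.
move=> Ou Ow; rewrite le_eqVlt => /predU1P[<-|a0].
  by rewrite scale0r addr0.
have /Omega_aP[r0 p0 E0] := Ou.
have /Omega_aP[r1 p1 E1] := Omega_a_scale a0 Ow.
apply/Omega_aP; split=> [|i|z].
- by rewrite rhoD addr_gt0.
- by rewrite pmassD addr_ge0.
- have := addr_gt0 (E0 z) (E1 z); rewrite /energy_at !stateD dotvDl.
  by congr (_ < _); ring.
Qed.

End AdmissibleCone.

(** * Entropy and its convexity *)

Section Thermodynamics.
Context {R : realType} {m d : nat} {M : mixture R m}.
Context (hCv : forall i, 0 < Cv M i) (hgam : forall i, 1 < gam M i).
Implicit Types (u w : state R m d) (Y : 'rV[R]_m) (n : 'rV[R]_d).

Lemma rgas_gt0 i : 0 < rgas M i.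
Proof.
have -> : rgas M i = (gam M i - 1) * Cv M i by rewrite /rgas /Cp; ring.
by rewrite mulr_gt0// subr_gt0.
Qed.

Lemma rmixE Y : rmix M Y = \sum_i massfrac Y i * rgas M i.
Proof.
by rewrite /rmix /Cpmix /Cvmix -sumrB; apply: eq_bigr => i _; rewrite mulrBr.
Qed.

Let massfrac_ge0 u : Omega_a u -> forall i, 0 <= massfrac (fracs u) i.
Proof. by case=> + _ _ i => /(_ i)/andP[]. Qed.

Lemma Cvmix_gt0 u : Omega_a u -> 0 < Cvmix M (fracs u).
Proof. by move=> /massfrac_ge0 Y0; exact: massfrac_mean_gt0. Qed.

Lemma rmix_gt0 u : Omega_a u -> 0 < rmix M (fracs u).
Proof.
move=> /massfrac_ge0 Y0; rewrite rmixE.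
by apply: massfrac_mean_gt0 => // i; exact: rgas_gt0.
Qed.

Lemma gammixB1 u : Omega_a u ->
  gammix M (fracs u) - 1 = rmix M (fracs u) / Cvmix M (fracs u).
Proof.
by move=> Ou; rewrite /gammix /rmix; field; exact/lt0r_neq0/Cvmix_gt0.
Qed.

(** [gammix] is the mean of the [gam M i] with weights [Y_i Cv_i]. *)
Lemma gammix_le_max u : Omega_a u -> gammix M (fracs u) <= gam_max M.
Proof.
move=> Ou; rewrite /gammix ler_pdivrMr ?Cvmix_gt0// mulr_sumr.
apply: ler_sum => i _; rewrite [leRHS]mulrCA ler_wpM2l ?massfrac_ge0//.
by rewrite /Cp ler_pM2r//; exact: le_bigmax.
Qed.

Lemma presE u : Omega_a u ->
  pres M u = rmix M (fracs u) / Cvmix M (fracs u) * rho u * eint u.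
Proof. by move=> Ou; rewrite /pres /pressure gammixB1. Qed.

Lemma pres_gt0 u : Omega_a u -> 0 < pres M u.
Proof.
move=> Ou; rewrite presE//; case: (Ou) => _ r0 e0.
by rewrite !(mulr_gt0, divr_gt0)// ?rmix_gt0 ?invr_gt0 ?Cvmix_gt0.
Qed.

Lemma temp_gt0 u : Omega_a u -> 0 < temp M u.
Proof. by move=> Ou; rewrite divr_gt0 ?Cvmix_gt0//; case: Ou. Qed.

(** The quotient p / T. Every partial density is this quantity divided by [rgas M i], so a single
    logarithm serves all components. *)
Let gasrho u := rho u * rmix M (fracs u).

Let gasrho_gt0 u : Omega_a u -> 0 < gasrho u.
Proof. by move=> Ou; rewrite mulr_gt0 ?rmix_gt0//; case: Ou. Qed.

Lemma s_partE i u : Omega_a u ->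
  s_part M i u = Cv M i * ln (temp M u) - rgas M i * ln (gasrho u)
    + rgas M i * ln (rgas M i) + Cv M i * ln (Cv M i) + sinf M i.
Proof.
move=> Ou; rewrite /s_part /theta /partial_rho lnV ?posrE ?temp_gt0//.
by rewrite ln_div ?posrE ?rgas_gt0 ?gasrho_gt0//; ring.
Qed.

Lemma etaE u : Omega_a u -> eta M u = - \sum_i pmass u i * s_part M i u.
Proof.
move=> Ou; have r0 : rho u != 0 by case: Ou => _ /lt0r_neq0.
rewrite /eta /entropy_s mulNr mulr_sumr; congr (- _).
by apply: eq_bigr => i _; rewrite pmassE// mulrA.
Qed.

(** Eliminates the last component, which passes from partial masses to the coordinates [rhoY], [rho]
    in which [eta'] is written. *)
Lemma sum_pmass (c : 'I_m.+1 -> R) u :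
  \sum_i pmass u i * c i = rho u * c ord_max +
    \sum_j rhoY u 0 j * (c (lift ord_max j) - c ord_max).
Proof.
rewrite (bigD1_ord ord_max)//= {1}/pmass unlift_none.
under eq_bigr do rewrite /pmass liftK.
under [in RHS]eq_bigr do rewrite mulrBr.
by rewrite sumrB -mulr_suml; ring.
Qed.

(** [Cp M i - s_part M i u] is the Gibbs potential of component i over the temperature. In this form
    [eta'] acts on partial masses and on the energy in the frame of [u], where the kinetic part of
    [u] itself disappears. *)
Lemma dotv_eta' u w : dotv (eta' M u) w =
  \sum_i pmass w i * (Cp M i - s_part M i u) - theta M u * energy_at (vel u) w.
Proof.
rewrite dotv_state /eta' !mkvecK sum_pmass /energy_at dotvZl (dotvC (vel u) (rhov w)).
rewrite [X in X + _ + _ + _](_ : _ = \sum_j rhoY w 0 j *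
  (Cp M (lift ord_max j) - s_part M (lift ord_max j) u
   - (Cp M ord_max - s_part M ord_max u))); first by field.
by apply: eq_bigr => j _; rewrite mxE; ring.
Qed.

(** The gap between the two sides splits into three nonnegative parts: [ln x <= x - 1] at the ratio
    of temperatures, the same at the ratio of the [gasrho], and the kinetic energy of the relative
    velocity. Convexity is thus obtained without differentiating [eta]. *)
Lemma eta_ge_tangent u w : Omega_a u -> Omega_a w ->
  eta M u + dotv (eta' M u) (w - u) <= eta M w.
Proof.
move=> Ou Ow.
have [_ ru eu] := Ou; have [_ rw ew] := Ow.
have [ru0 rw0] := (lt0r_neq0 ru, lt0r_neq0 rw).
have Tu := temp_gt0 Ou; have Tw := temp_gt0 Ow.
have Pu := gasrho_gt0 Ou; have Pw := gasrho_gt0 Ow.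
have Cu := Cvmix_gt0 Ou; have Cw := Cvmix_gt0 Ow.
rewrite dotvBr !dotv_eta' !etaE// !energy_atE// subrr dotv0l.
set D := dotv _ _.
have D0 : 0 <= D by exact: dotvv_ge0.
have sumM v (c : 'I_m.+1 -> R) : rho v != 0 ->
    \sum_i pmass v i * c i = rho v * \sum_i massfrac (fracs v) i * c i.
  by move=> v0; rewrite mulr_sumr; apply: eq_bigr => i _; rewrite pmassE// mulrA.
have sumB v (f g : 'I_m.+1 -> R) : \sum_i pmass v i * (f i - g i) =
    \sum_i pmass v i * f i - \sum_i pmass v i * g i.
  by rewrite -sumrB; apply: eq_bigr => i _; rewrite mulrBr.
have Cps v : rho v != 0 ->
    \sum_i pmass v i * Cp M i = rho v * Cvmix M (fracs v) + gasrho v.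
  by move=> v0; rewrite sumM// /gasrho /rmix -/(Cpmix M (fracs v)); ring.
(* The component constants are the same in both states and cancel; only the two ratios remain. *)
have sw : \sum_i pmass w i * s_part M i w = \sum_i pmass w i * s_part M i u
    + rho w * Cvmix M (fracs w) * ln (temp M w / temp M u)
    + gasrho w * ln (gasrho u / gasrho w).
  set lT := ln (temp M w / _); set lP := ln (gasrho u / _).
  have -> : gasrho w = \sum_i pmass w i * rgas M i by rewrite sumM// /gasrho rmixE.
  rewrite /Cvmix -sumM// !mulr_suml -!big_split/=; apply: eq_bigr => i _.
  by rewrite !s_partE// /lT /lP !ln_div ?posrE//; ring.
have l1 := ln_le_subr1 (divr_gt0 Tw Tu).
have l2 := ln_le_subr1 (divr_gt0 Pu Pw).
have h1 : rho w * Cvmix M (fracs w) * ln (temp M w / temp M u) <=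
    rho w * Cvmix M (fracs w) * (temp M w / temp M u - 1).
  by rewrite ler_pM2l// mulr_gt0.
have h2 : gasrho w * ln (gasrho u / gasrho w) <=
    gasrho w * (gasrho u / gasrho w - 1) by rewrite ler_pM2l.
have h3 : gasrho w * (gasrho u / gasrho w - 1) = gasrho u - gasrho w.
  by field; exact: lt0r_neq0.
have h4 : theta M u * (rho u * eint u) = rho u * Cvmix M (fracs u).
  by rewrite /theta /temp; field; rewrite !lt0r_neq0.
have h5 : theta M u * (rho w * eint w) =
    rho w * Cvmix M (fracs w) * (temp M w / temp M u).
  rewrite /theta /temp; field.
  by rewrite !lt0r_neq0// mulf_neq0 ?invr_eq0 ?lt0r_neq0.
have h6 : 0 <= theta M u * (rho w * (D / 2)).
  by rewrite !mulr_ge0 ?invr_ge0// ?ltW.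
rewrite sw !sumB !Cps//.
move: h1 h2 h3 h4 h5 h6; rewrite !(mulrDr, mulrN, mul0r, mulr0, addr0); lra.
Qed.

End Thermodynamics.

(** * Intermediate states of the Riemann solver *)

Section StarState.
Context {R : realType} {m d : nat} {M : mixture R m}.
Context (hCv : forall i, 0 < Cv M i) (hgam : forall i, 1 < gam M i).
Context (gamma : R) (hgamma : gam_max M < gamma).
Context (n : 'rV[R]_d) (hn : dotv n n = 1).
Implicit Types (u w : state R m d) (eps us ps X a : R).

(* The intermediate state adjacent to u: eps = 1 gives u*_L, eps = -1 gives u*_R. *)
Definition star eps u a us ps : state R m d :=
  let r := ((rho u)^-1 + eps * (us - un n u) / a)^-1 in
  mkvec (r *: fracs u) r (r *: (vel u + (us - un n u) *: n))
        (r * (Etot u - eps * (ps * us - pres M u * un n u) / a)).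

Lemma gamma_gt1 : 1 < gamma.
Proof.
apply: lt_trans (hgam ord0) _; apply: le_lt_trans hgamma; exact: le_bigmax.
Qed.

Lemma c_gamma_gt0 u : Omega_a u -> 0 < c_gamma gamma (rho u) (pres M u).
Proof.
move=> Ou; have [_ r0 _] := Ou; rewrite sqrtr_gt0 divr_gt0// mulr_gt0 ?pres_gt0//.
exact: lt_trans ltr01 gamma_gt1.
Qed.

Lemma sqr_c_gamma u : Omega_a u ->
  c_gamma gamma (rho u) (pres M u) ^+ 2
  = gamma * (rmix M (fracs u) / Cvmix M (fracs u)) * eint u.
Proof.
move=> Ou; have [_ r0 _] := Ou.
rewrite sqr_sqrtr; last first.
  rewrite divr_ge0 ?(ltW r0)// mulr_ge0 ?ltW ?pres_gt0//.
  exact: lt_trans ltr01 gamma_gt1.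
by rewrite presE//; field; rewrite !lt0r_neq0// Cvmix_gt0.
Qed.

Section OneState.
(** [X] abstracts the positive part in the Lagrangian speed. [haX] is the definition of that speed,
    [hus] limits the compression by [X], and [hps] is the momentum relation across the wave. *)
Variables (eps : R) (u : state R m d) (a us ps X : R).
Hypotheses (Ou : Omega_a u) (heps : eps ^+ 2 = 1) (X0 : 0 <= X).
Hypothesis (haX : a = rho u *
  (c_gamma gamma (rho u) (pres M u) + (gamma + 1) / 2 * X)).
Hypothesis (hus : - X <= eps * (us - un n u)).
Hypothesis (hps : ps = pres M u - eps * a * (us - un n u)).

Let c := c_gamma gamma (rho u) (pres M u).
Let k := rmix M (fracs u) / Cvmix M (fracs u).
Let t := 1 + rho u * (eps * (us - un n u)) / a.
Let y := X / c.
Let al := (gamma + 1) / 2.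

Let c0 : 0 < c. Proof. exact: c_gamma_gt0. Qed.
Let r0 : 0 < rho u. Proof. by case: Ou. Qed.
Let e0 : 0 < eint u. Proof. by case: Ou. Qed.
Let al1 : 1 < al. Proof. by have := gamma_gt1; rewrite /al; lra. Qed.
Let y0 : 0 <= y. Proof. by rewrite divr_ge0// ltW. Qed.
Let aly0 : 0 < 1 + al * y.
Proof. by rewrite ltr_pwDl// mulr_ge0//; have := al1; lra. Qed.
Let aE : a = rho u * c * (1 + al * y).
Proof. by rewrite haX -/c -/al /y; field; exact: lt0r_neq0. Qed.

Lemma star_speed_gt0 : 0 < a.
Proof. by rewrite aE !mulr_gt0. Qed.
Let a0 := star_speed_gt0.

(** The left side is the ratio of specific volumes [t] at the extreme compression allowed by [hus];
    it is the threshold of [powR_le_subcharacteristic]. *)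
Let t_ge : (1 + (al - 1) * y) / (1 + al * y) <= t.
Proof.
have -> : (1 + (al - 1) * y) / (1 + al * y) = 1 + rho u * (- X) / a.
  rewrite aE /y; field; rewrite !lt0r_neq0//=.
  by have := aly0; rewrite /y; set z := c + _; have -> : z = c * (1 + al * (X / c));
    [rewrite /z; field; exact: lt0r_neq0|move=> ?; exact: mulr_gt0].
by rewrite lerD2l ler_pM2r ?invr_gt0// ler_pM2l.
Qed.

Let t0 : 0 < t.
Proof.
apply: lt_le_trans t_ge; rewrite divr_gt0// ltr_pwDl// mulr_ge0//.
by have := al1; lra.
Qed.

Let k0 : 0 < k. Proof. by rewrite divr_gt0 ?rmix_gt0 ?Cvmix_gt0. Qed.

Let powt : t `^ (- k) <=
  1 - k * (t - 1) + (gamma * k * (1 + al * y) ^+ 2) / 2 * (t - 1) ^+ 2.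
Proof.
apply: powR_le_subcharacteristic => //.
by have := gammix_le_max hCv Ou; have := gammixB1 hCv Ou; rewrite -/k; have := hgamma; lra.
Qed.

Let r := ((rho u)^-1 + eps * (us - un n u) / a)^-1.

Let rE : r = rho u / t.
Proof.
have -> : t = rho u * ((rho u)^-1 + eps * (us - un n u) / a).
  by rewrite /t; field; rewrite !lt0r_neq0.
by rewrite invfM mulrA divff ?mul1r ?lt0r_neq0.
Qed.

Let rs0 : 0 < r. Proof. by rewrite rE divr_gt0. Qed.

(** The distance from the acoustic wave to the contact is [a] times the specific volume of the star
    state, so the order of the waves is the positivity of [t]. *)
Lemma star_wave_lt_contact :
  0 < eps * (us - (un n u - eps * a / rho u)).
Proof.
suff -> : eps * (us - (un n u - eps * a / rho u)) = a / rho u * t.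
  by rewrite mulr_gt0// divr_gt0.
by rewrite /t; field : heps; rewrite !lt0r_neq0.
Qed.

Let w := star eps u a us ps.

Lemma rho_starE : rho w = rho u / t.
Proof. by rewrite rho_mkvec -/r rE. Qed.

Lemma rho_star_gt0 : 0 < rho w.
Proof. by rewrite rho_starE divr_gt0. Qed.

Lemma fracs_star : fracs w = fracs u.
Proof. by rewrite /fracs !mkvecK -/r scalerA mulVf ?scale1r// lt0r_neq0. Qed.

Lemma vel_star : vel w = vel u + (us - un n u) *: n.
Proof. by rewrite /vel !mkvecK -/r scalerA mulVf ?scale1r// lt0r_neq0. Qed.

Lemma un_star : un n w = us.
Proof. by rewrite {1}/un vel_star dotvDl dotvZl hn -/(un n u); ring. Qed.

Lemma Etot_star : Etot w = Etot u - eps * (ps * us - pres M u * un n u) / a.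
Proof. by rewrite /Etot !mkvecK -/r mulrC mulKf ?lt0r_neq0. Qed.

Let eint_star : eint w = eint u *
  (1 - k * (t - 1) + (gamma * k * (1 + al * y) ^+ 2) / 2 * (t - 1) ^+ 2).
Proof.
have -> : eint w = eint u - pres M u * (eps * (us - un n u)) / a
    + (us - un n u) ^+ 2 / 2.
  rewrite /eint Etot_star vel_star dotvDl !dotvDr.
  rewrite !(dotvZl (us - un n u)) !(dotvZr (us - un n u)) hn.
  rewrite (dotvC n) -/(un n u) hps; field : heps.
  exact: lt0r_neq0.
have -> : eint u * (1 - k * (t - 1)
    + (gamma * k * (1 + al * y) ^+ 2) / 2 * (t - 1) ^+ 2) =
    eint u - eint u * k * (t - 1)
    + (gamma * k * eint u) * (1 + al * y) ^+ 2 * (t - 1) ^+ 2 / 2 by field.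
(* As [c^2 = gamma k e] and [a = rho c (1 + al y)], the quadratic term in [t - 1] equals
   [(us - un n u)^2 / 2]. *)
rewrite -sqr_c_gamma// -/c presE// -/k /t.
have -> : (us - un n u) ^+ 2 = eps ^+ 2 * (us - un n u) ^+ 2 by rewrite heps mul1r.
have -> : (1 + rho u * (eps * (us - un n u)) / a - 1) =
  rho u * (eps * (us - un n u)) / a by ring.
have -> : c ^+ 2 * (1 + al * y) ^+ 2 * (rho u * (eps * (us - un n u)) / a) ^+ 2
  = (rho u * c * (1 + al * y)) ^+ 2 * (eps * (us - un n u)) ^+ 2 / a ^+ 2.
  by field; exact: lt0r_neq0.
by rewrite -aE; field; exact: lt0r_neq0.
Qed.

Lemma star_Omega : Omega_a w.
Proof.
split; last first.
- by rewrite eint_star mulr_gt0// (lt_le_trans _ powt)// powR_gt0.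
- exact: rho_star_gt0.
- by rewrite fracs_star; case: Ou.
Qed.

(** The mass fractions do not change across the wave, so the entropy increases by
    [Cv (ln (e_star / e) + k ln t)]. This is nonnegative by the logarithm of [powt]. *)
Lemma entropy_star : entropy_s M u <= entropy_s M w.
Proof.
have Ow := star_Omega.
have Tw : temp M w / temp M u =
    1 - k * (t - 1) + (gamma * k * (1 + al * y) ^+ 2) / 2 * (t - 1) ^+ 2.
  rewrite /temp fracs_star eint_star; field.
  by rewrite !lt0r_neq0// ?Cvmix_gt0// mulf_neq0 ?invr_eq0 ?lt0r_neq0 ?Cvmix_gt0.
have Pw : rho w * rmix M (fracs w) / (rho u * rmix M (fracs u)) = t^-1.
  by rewrite fracs_star rho_starE; field; rewrite !lt0r_neq0// rmix_gt0.
rewrite -subr_ge0 /entropy_s fracs_star -sumrB.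
rewrite (eq_bigr (fun i => massfrac (fracs u) i * Cv M i * ln (temp M w / temp M u)
   + massfrac (fracs u) i * rgas M i * ln t)); last first.
  move=> i _; rewrite !s_partE// fracs_star ln_div ?posrE ?temp_gt0//.
  have -> : ln t = - ln (t^-1) by rewrite lnV ?posrE// opprK.
  by rewrite -Pw fracs_star ln_div ?posrE ?mulr_gt0 ?rmix_gt0 ?rho_star_gt0//; ring.
rewrite big_split/= -!mulr_suml -rmixE -/(Cvmix M (fracs u)) Tw.
have C0 := Cvmix_gt0 hCv Ou.
have -> : rmix M (fracs u) = Cvmix M (fracs u) * k.
  by rewrite /k; field; exact: lt0r_neq0.
have : ln (t `^ (- k)) <= ln (1 - k * (t - 1)
    + (gamma * k * (1 + al * y) ^+ 2) / 2 * (t - 1) ^+ 2).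
  by rewrite ler_ln// posrE ?powR_gt0// (lt_le_trans _ powt)// powR_gt0.
rewrite ln_powR; set phi := ln (1 - k * (t - 1) + _) => lnphi.
have : 0 <= Cvmix M (fracs u) * (phi + k * ln t) by rewrite mulr_ge0 ?(ltW C0)//; lra.
by rewrite mulrDr mulrA.
Qed.

Lemma eta_star : eta M w <= - rho w * entropy_s M u.
Proof. by rewrite /eta !mulNr lerN2 ler_pM2l ?rho_star_gt0// entropy_star. Qed.

(** Rankine-Hugoniot relation of the acoustic wave, with the relaxation pressure [ps] in the star
    state. *)
Lemma star_jump : flux_with_pressure ps w n - flux M u n =
  (un n u - eps * a / rho u) *: (w - u).
Proof.
have rn := lt0r_neq0 r0; have rsn := lt0r_neq0 rho_star_gt0.
have an := lt0r_neq0 a0.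
(* The mass flux relative to the wave is [eps * a], on the star side as on the side of [u]. *)
have S : rho w * (us - (un n u - eps * a / rho u)) = eps * a.
  rewrite rho_starE.
  have -> : us - (un n u - eps * a / rho u) = eps * a / rho u * t.
    by rewrite /t; field : heps; rewrite an rn.
  by field; rewrite !lt0r_neq0.
(* Hence a quantity carried with the mass, with specific values [x] and [z] on the two sides,
   contributes [eps * a * (z - x)]; pressure terms then balance the velocity and energy jumps. *)
have jump (x z : R) : us * (rho w * z) - un n u * (rho u * x)
  - (un n u - eps * a / rho u) * (rho w * z - rho u * x) = eps * a * (z - x).
  have -> : us * (rho w * z) - un n u * (rho u * x)
    - (un n u - eps * a / rho u) * (rho w * z - rho u * x)
    = rho w * (us - (un n u - eps * a / rho u)) * z - eps * a * x by field.
  by rewrite S; ring.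
move: fracs_star vel_star un_star Etot_star; clearbody w => fw vw uw Ew.
apply: state_ext; rewrite ?(stateB, stateZ) ?mkvecK uw.
- rewrite (rho_fracs rn) (rho_fracs rsn) fw; apply/rowP => i.
  by have := jump (fracs u 0 i) (fracs u 0 i); rewrite subrr mulr0 !mxE; lra.
- by have := jump 1 1; rewrite !mulr1 subrr mulr0; lra.
- rewrite (rho_vel rn) (rho_vel rsn) vw.
  apply/rowP => i; rewrite !mxE.
  have := jump (vel u 0 i) (vel u 0 i + (us - un n u) * n 0 i).
  rewrite hps !mxE; lra.
- rewrite (rho_Etot rn) (rho_Etot rsn) Ew.
  have := jump (Etot u) (Etot u - eps * (ps * us - pres M u * un n u) / a).
  have -> : eps * a * (Etot u - eps * (ps * us - pres M u * un n u) / a - Etot u)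
    = pres M u * un n u - ps * us by field : heps.
  rewrite -/(pres M u); lra.
Qed.
End OneState.
End StarState.

Arguments star {R m d} M n eps u a us ps.

(** * Lagrangian speeds and the three waves between two states *)

Section Fan.
Context {R : realType} {m d : nat} {M : mixture R m}.
Context (hCv : forall i, 0 < Cv M i) (hgam : forall i, 1 < gam M i).
Context (gamma : R) (hgamma : gam_max M < gamma).
Context (n : 'rV[R]_d) (hn : dotv n n = 1).
Implicit Types (u w : state R m d).

Lemma pos_ge0 (x : R) : 0 <= pos x.
Proof. by rewrite /pos le_max lexx orbT. Qed.

Lemma pos_ge (x : R) : x <= pos x.
Proof. by rewrite /pos le_max lexx. Qed.

Section TwoStates.
Variables uL uR : state R m d.
Hypotheses (OL : Omega_a uL) (OR : Omega_a uR).

Notation cL := (c_gamma gamma (rho uL) (pres M uL)).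
Notation cR := (c_gamma gamma (rho uR) (pres M uR)).
Notation al := ((gamma + 1) / 2).
Notation vL := (un n uL).
Notation vR := (un n uR).
Notation pL := (pres M uL).
Notation pR := (pres M uR).
Notation aL := (aL M gamma n uL uR).
Notation aR := (aR M gamma n uL uR).
Notation us := (ustar M gamma n uL uR).
Notation ps := (pstar M gamma n uL uR).
Notation w1 := (uLstar M gamma n uL uR).
Notation w2 := (uRstar M gamma n uL uR).
Notation sL := (SL M gamma n uL uR).
Notation sR := (SR M gamma n uL uR).

Let rL0 : 0 < rho uL. Proof. by case: OL. Qed.
Let rR0 : 0 < rho uR. Proof. by case: OR. Qed.
Let cL0 : 0 < cL. Proof. exact: c_gamma_gt0. Qed.
Let cR0 : 0 < cR. Proof. exact: c_gamma_gt0. Qed.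
Let al0 : 0 < al. Proof. by have := gamma_gt1 hgam hgamma; lra. Qed.

(** [XL] and [XR] are the positive parts in the definition of the speeds. The last two inequalities,
    divided by [aL + aR], are the compression bounds [hus] for the left and the right star state. *)
Lemma lagrangian_speedsP : exists XL XR : R,
  [/\ 0 <= XL, 0 <= XR, aL = rho uL * (cL + al * XL) &
      [/\ aR = rho uR * (cR + al * XR), pR - pL + aR * (vL - vR) <= XL * (aL + aR)
      & pL - pR + aL * (vL - vR) <= XR * (aL + aR)]].
Proof.
have speed_gt0 r c X : 0 < r -> 0 < c -> 0 <= X -> 0 < r * (c + al * X).
  by move=> ? ? ?; rewrite mulr_gt0// ltr_pwDl// mulr_ge0// ltW.
have bound (a b q v X : R) : 0 < a -> 0 < b -> 0 <= X -> q / b + v <= X ->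
    q + b * v <= X * (a + b).
  move=> a0 b0 X0 qX; have : (q / b + v) * b <= X * b by rewrite ler_pM2r.
  have -> : (q / b + v) * b = q + b * v by field; exact: lt0r_neq0.
  by move/le_trans; apply; rewrite ler_wpM2l//; lra.
rewrite /Defs.aL /Defs.aR /lagrangian_speeds.
have [pLR|pRL] := leP pL pR => /=.
- set XL := pos ((pR - pL) / _ + _ - _).
  set a := rho uL * _; set XR := pos ((pL - pR) / _ + _ - _).
  have XL0 : 0 <= XL by exact: pos_ge0.
  have XR0 : 0 <= XR by exact: pos_ge0.
  have a0 : 0 < a by exact: speed_gt0.
  set b := rho uR * _; have b0 : 0 < b by exact: speed_gt0.
  exists XL, XR; split=> //; split=> //; last first.
    by rewrite (addrC a); apply: bound => //; rewrite addrA; exact: pos_ge.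
  (* The speed computed first uses [rho c] of the opposite state instead of its Lagrangian speed.
     The latter is larger and the pressure jump has the favourable sign, so the bound persists. *)
  apply: bound => //; apply: le_trans (pos_ge _); rewrite !addrA !lerD2r.
  rewrite ler_wpM2l ?subr_ge0// lef_pV2 ?posrE ?(mulr_gt0 rR0 cR0)//.
  by rewrite ler_pM2l// lerDl mulr_ge0// ltW.
- set XR := pos ((pL - pR) / _ + _ - _).
  set b := rho uR * _; set XL := pos ((pR - pL) / _ + _ - _).
  have XL0 : 0 <= XL by exact: pos_ge0.
  have XR0 : 0 <= XR by exact: pos_ge0.
  have b0 : 0 < b by exact: speed_gt0.
  set a := rho uL * _; have a0 : 0 < a by exact: speed_gt0.
  exists XL, XR; split=> //; split=> //.
    by apply: bound => //; rewrite addrA; exact: pos_ge.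
  rewrite (addrC a); apply: bound => //; apply: le_trans (pos_ge _).
  rewrite !addrA !lerD2r.
  rewrite ler_wpM2l ?subr_ge0 ?(ltW pRL)// lef_pV2 ?posrE ?(mulr_gt0 rL0 cL0)//.
  by rewrite ler_pM2l// lerDl mulr_ge0// ltW.
Qed.

Lemma aL_gt0 : 0 < aL.
Proof.
have [XL [XR [XL0 _ -> _]]] := lagrangian_speedsP.
by rewrite mulr_gt0// ltr_pwDl// mulr_ge0// ltW.
Qed.

Lemma aR_gt0 : 0 < aR.
Proof.
have [XL [XR [_ XR0 _ [-> _ _]]]] := lagrangian_speedsP.
by rewrite mulr_gt0// ltr_pwDl// mulr_ge0// ltW.
Qed.

Let a0 := aL_gt0.
Let b0 := aR_gt0.
Let ab0 : aL + aR != 0. Proof. by apply: lt0r_neq0; rewrite addr_gt0. Qed.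

Lemma pstarL : ps = pL - 1 * aL * (us - vL).
Proof. by rewrite /pstar /ustar; field. Qed.

Lemma pstarR : ps = pR - (-1) * aR * (us - vR).
Proof. by rewrite /pstar /ustar; field. Qed.

Lemma uLstarE : w1 = star M n 1 uL aL us ps.
Proof. by rewrite /uLstar /star /rhoLstar /ELstar !mul1r. Qed.

Lemma uRstarE : w2 = star M n (-1) uR aR us ps.
Proof.
rewrite /uRstar /star.
have -> : -1 * (us - vR) = vR - us by ring.
have -> : -1 * (ps * us - pR * vR) = pR * vR - ps * us by ring.
by [].
Qed.

Lemma star_statesP :
  [/\ Omega_a w1, eta M w1 <= - rho w1 * entropy_s M uL, un n w1 = us,
      flux_with_pressure ps w1 n - flux M uL n = sL *: (w1 - uL) & sL <= us] /\
  [/\ Omega_a w2, eta M w2 <= - rho w2 * entropy_s M uR, un n w2 = us,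
      flux M uR n - flux_with_pressure ps w2 n = sR *: (uR - w2) & us <= sR].
Proof.
have [XL [XR [XL0 XR0 aLE [aRE hL hR]]]] := lagrangian_speedsP.
have ab : 0 < aL + aR by rewrite addr_gt0.
have usL : - XL <= 1 * (us - vL).
  rewrite -(ler_pM2r ab); suff -> : 1 * (us - vL) * (aL + aR) =
    - (pR - pL + aR * (vL - vR)) by rewrite mulNr lerN2.
  by rewrite /ustar; field.
have usR : - XR <= -1 * (us - vR).
  rewrite -(ler_pM2r ab); suff -> : -1 * (us - vR) * (aL + aR) =
    - (pL - pR + aL * (vL - vR)) by rewrite mulNr lerN2.
  by rewrite /ustar; field.
have e1 : 1 ^+ 2 = 1 :> R by rewrite expr1n.
have e2 : (-1) ^+ 2 = 1 :> R by rewrite sqrrN expr1n.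
rewrite uLstarE uRstarE; split; split.
- exact: (star_Omega hCv hgam hgamma hn OL e1 XL0 aLE usL pstarL).
- exact: (eta_star hCv hgam hgamma hn OL e1 XL0 aLE usL pstarL).
- exact: (un_star hCv hgam hgamma hn ps OL XL0 aLE usL).
- rewrite (star_jump hCv hgam hgamma hn OL e1 XL0 aLE usL pstarL).
  by rewrite /SL mul1r.
- have := star_wave_lt_contact hCv hgam hgamma OL e1 XL0 aLE usL.
  by rewrite !mul1r -/sL; lra.
- exact: (star_Omega hCv hgam hgamma hn OR e2 XR0 aRE usR pstarR).
- exact: (eta_star hCv hgam hgamma hn OR e2 XR0 aRE usR pstarR).
- exact: (un_star hCv hgam hgamma hn ps OR XR0 aRE usR).
- rewrite -opprB (star_jump hCv hgam hgamma hn OR e2 XR0 aRE usR pstarR).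
  by rewrite -scalerN opprB /SR mulN1r mulNr opprK.
- have := star_wave_lt_contact hCv hgam hgamma OR e2 XR0 aRE usR.
  by rewrite !mulN1r mulNr opprK -/sR; lra.
Qed.

Notation h := (num_flux M gamma uL uR n).
Notation Q := (num_entropy_flux M gamma uL uR n).

Lemma flux_with_pressure_split p u : rho u != 0 ->
  flux_with_pressure p u n = un n u *: u + p *: mkvec 0 0 n (un n u).
Proof.
move=> r0; apply: state_ext; rewrite ?(stateD, stateZ) !mkvecK.
- by rewrite scaler0 addr0.
- by rewrite mulr0 addr0 mulrC.
- by rewrite (rho_vel r0) scalerA (mulrC (un n u)).
- by ring.
Qed.

(** Both star states share the normal velocity [us] and the pressure [ps], so the pressure parts of
    the fluxes cancel and pure transport remains. *)
Lemma contact_jump :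
  flux_with_pressure ps w2 n - flux_with_pressure ps w1 n = us *: (w2 - w1).
Proof.
have [[[_ /lt0r_neq0 r1 _] _ u1 _ _] [[_ /lt0r_neq0 r2 _] _ u2 _ _]] := star_statesP.
by rewrite !flux_with_pressure_split// u1 u2 opprD addrACA subrr addr0 scalerBr.
Qed.

(** Starting from [uL], the jumps of the waves with negative speed are added. As the speeds are
    ordered, the minima vanish from the first nonnegative speed on, in accordance with the branches
    of [riemann]. *)
Lemma num_flux_minE : h = flux M uL n + Num.min sL 0 *: (w1 - uL)
  + Num.min us 0 *: (w2 - w1) + Num.min sR 0 *: (uR - w2).
Proof.
have [[_ _ _ jL sLu] [_ _ _ jR usR]] := star_statesP; have jC := contact_jump.
rewrite /num_flux /riemann.
have [sL0|sL0] := leP 0 sL.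
  by rewrite !min_r ?scale0r ?addr0//; lra.
rewrite -jL [flux M uL n + _]addrC subrK.
have [us0|us0] := leP 0 us.
  by rewrite !min_r ?scale0r ?addr0//; lra.
rewrite -jC [_ + (_ - _)]addrC subrK.
have [sR0|sR0] := leP 0 sR.
  by rewrite scale0r addr0.
by rewrite -jR [_ + (_ - _)]addrC subrK.
Qed.

Lemma num_flux_maxE : h = flux M uR n - Num.max sL 0 *: (w1 - uL)
  - Num.max us 0 *: (w2 - w1) - Num.max sR 0 *: (uR - w2).
Proof.
have [[_ _ _ jL _] [_ _ _ jR _]] := star_statesP; have jC := contact_jump.
have minE (x : R) : Num.min x 0 = x - Num.max x 0.
  by have [x0|x0] := leP x 0; rewrite ?subr0 ?subrr.
(* The three jump relations telescope; subtracting the waves of positive speed from the right then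
   gives the same flux. *)
have -> : flux M uR n = flux M uL n + sL *: (w1 - uL) + us *: (w2 - w1)
    + sR *: (uR - w2).
  rewrite -jL [flux M uL n + _]addrC subrK -jC [_ + (_ - _)]addrC subrK.
  by rewrite -jR addrC subrK.
rewrite num_flux_minE !minE.
move: (flux M uL n) (w1 - uL) (w2 - w1) (uR - w2) => f x y z.
by apply/rowP => i; rewrite !mxE; ring.
Qed.

End TwoStates.
End Fan.

(** * Entropy fans *)

Section FanScalars.
Context {R : realType}.

Lemma min0_le (x y : R) : x <= y -> Num.min x 0 <= Num.min y 0.
Proof. by move=> xy; rewrite le_min !ge_min xy lexx orbT. Qed.

Lemma max0_le (x y : R) : x <= y -> Num.max x 0 <= Num.max y 0.
Proof. by move=> xy; rewrite ge_max !le_max xy lexx orbT. Qed.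

Lemma oppr_min0_le (v a : R) : 0 <= a -> - Num.min (v - a) 0 <= `|v| + a.
Proof.
move=> a0; have := ler_norm (- v); rewrite normrN => vv.
by have := normr_ge0 v; case: (leP (v - a) 0); lra.
Qed.

Lemma max0_le_normD (v a : R) : 0 <= a -> Num.max (v + a) 0 <= `|v| + a.
Proof.
move=> a0; have := ler_norm v => vv.
by have := normr_ge0 v; case: (leP (v + a) 0); lra.
Qed.

Variables (s1 s2 s3 rL r1 r2 rR H sl sr y1 y2 : R).
Hypotheses (s12 : s1 <= s2) (s23 : s2 <= s3).
Hypotheses (hy1 : y1 <= - r1 * sl) (hy2 : y2 <= - r2 * sr).

(** Here [r1], [r2], [rL], [rR] are densities, [sl] and [sr] specific entropies, [y1] and [y2]
    entropies of the star states, [qL] and [H] mass fluxes. When [y1] and [y2] attain their bounds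
    the claim is an equality, the balance of an entropy transported with the mass; monotonicity of
    the truncated speeds gives the inequality. *)
Lemma fan_entropy_left (qL : R) :
  r1 * s2 - qL = s1 * (r1 - rL) ->
  H = qL + Num.min s1 0 * (r1 - rL) + Num.min s2 0 * (r2 - r1)
    + Num.min s3 0 * (rR - r2) ->
  (Num.min s2 0 - Num.min s1 0) * (y1 - - rL * sl)
  + (Num.min s3 0 - Num.min s2 0) * (y2 - - rL * sl)
  + - Num.min s3 0 * (- rR * sr - - rL * sl)
  <= - qL * sl - (if 0 <= s2 then - H * sl else - H * sr).
Proof.
move=> hq hH.
have a1 : 0 <= Num.min s2 0 - Num.min s1 0 by rewrite subr_ge0 min0_le.
have a2 : 0 <= Num.min s3 0 - Num.min s2 0 by rewrite subr_ge0 min0_le.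
have h1 := ler_wpM2l a1 hy1; have h2 := ler_wpM2l a2 hy2.
(* The mass jump is multiplied by each entropy beforehand, so that the claim becomes linear in the
   monomials. *)
have e1 : (r1 * s2 - qL - s1 * (r1 - rL)) * sl = 0 by rewrite hq subrr mul0r.
have e2 : (r1 * s2 - qL - s1 * (r1 - rL)) * sr = 0 by rewrite hq subrr mul0r.
have [s20|s20] := leP 0 s2.
  have m2 : Num.min s2 0 = 0 by rewrite min_r.
  have m3 : Num.min s3 0 = 0 by rewrite min_r// (le_trans s20).
  rewrite hH m2 m3 in h1 h2 *; move: (Num.min s1 0) h1 h2 => m1 h1 h2.
  lra.
have m2 : Num.min s2 0 = s2 by rewrite min_l// ltW.
have m1 : Num.min s1 0 = s1 by rewrite min_l// ltW// (le_lt_trans s12).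
rewrite hH m1 m2 in h1 h2 *; move: (Num.min s3 0) h1 h2 => m3 h1 h2.
lra.
Qed.

Lemma fan_entropy_right (qR : R) :
  qR - r2 * s2 = s3 * (rR - r2) ->
  H = qR - Num.max s1 0 * (r1 - rL) - Num.max s2 0 * (r2 - r1)
    - Num.max s3 0 * (rR - r2) ->
  Num.max s1 0 * (- rL * sl - - rR * sr)
  + (Num.max s2 0 - Num.max s1 0) * (y1 - - rR * sr)
  + (Num.max s3 0 - Num.max s2 0) * (y2 - - rR * sr)
  <= (if 0 <= s2 then - H * sl else - H * sr) - - qR * sr.
Proof.
move=> hq hH.
have a1 : 0 <= Num.max s2 0 - Num.max s1 0 by rewrite subr_ge0 max0_le.
have a2 : 0 <= Num.max s3 0 - Num.max s2 0 by rewrite subr_ge0 max0_le.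
have h1 := ler_wpM2l a1 hy1; have h2 := ler_wpM2l a2 hy2.
have e1 : (qR - r2 * s2 - s3 * (rR - r2)) * sl = 0 by rewrite hq subrr mul0r.
have e2 : (qR - r2 * s2 - s3 * (rR - r2)) * sr = 0 by rewrite hq subrr mul0r.
have [s20|s20] := leP 0 s2.
  have m2 : Num.max s2 0 = s2 by rewrite max_l.
  have m3 : Num.max s3 0 = s3 by rewrite max_l// (le_trans s20).
  rewrite hH m2 m3 in h1 h2 *; move: (Num.max s1 0) h1 h2 => m1 h1 h2.
  lra.
have m2 : Num.max s2 0 = 0 by rewrite max_r// ltW.
have m1 : Num.max s1 0 = 0 by rewrite max_r// ltW// (le_lt_trans s12).
rewrite hH m1 m2 in h1 h2 *; move: (Num.max s3 0) h1 h2 => m3 h1 h2.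
lra.
Qed.

End FanScalars.

Section EntropyFan.
Context {R : realType} {m d : nat} {M : mixture R m}.
Context (hCv : forall i, 0 < Cv M i) (hgam : forall i, 1 < gam M i).
Implicit Types (u v w : state R m d) (L dq : R).

(* One half of a Riemann fan seen from the cell in state u: over a time step
   lam, u + lam *: v mixes u with at most three other admissible states, of
   total weight at most lam * L, and dq bounds the rate of change of the mean
   entropy. *)
Definition entropy_fan u L v dq := exists A1 A2 A3 w1 w2 w3,
  [/\ [/\ 0 <= A1, 0 <= A2 & 0 <= A3], [/\ Omega_a w1, Omega_a w2 & Omega_a w3],
      A1 + A2 + A3 <= L,
      v = A1 *: (w1 - u) + A2 *: (w2 - u) + A3 *: (w3 - u) &
      A1 * (eta M w1 - eta M u) + A2 * (eta M w2 - eta M u)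
      + A3 * (eta M w3 - eta M u) <= dq].

(** Weighted sum of the tangent inequalities at [u]. Applied to both halves of one fan it yields
    Tadmor's inequality. *)
Lemma entropy_fan_tangent u L v dq : Omega_a u -> entropy_fan u L v dq ->
  dotv (eta' M u) v <= dq.
Proof.
move=> Ou [A1 [A2 [A3 [w1 [w2 [w3 [[a1 a2 a3] [Ow1 Ow2 Ow3] _ -> h]]]]]]].
apply: le_trans h; rewrite !dotvDr !dotvZr !lerD// ler_wpM2l// lerBrDl;
  exact: eta_ge_tangent.
Qed.

(** Each half fan uses less than half of the cell, so [V] is a convex combination of [u], with
    positive weight [c], and six admissible states. The entropy bound is Jensen's inequality,
    obtained from the tangent at [V]. *)
Lemma entropy_fan_update u v1 v2 L1 L2 dq1 dq2 (lam : R) : Omega_a u -> 0 <= lam ->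
  lam * L1 < 2^-1 -> lam * L2 < 2^-1 ->
  entropy_fan u L1 v1 dq1 -> entropy_fan u L2 v2 dq2 ->
  let V := u + lam *: (v1 + v2) in
  Omega_a V /\ eta M V <= eta M u + lam * (dq1 + dq2).
Proof.
move=> Ou lam0 l1 l2.
move=> [A1 [A2 [A3 [w1 [w2 [w3 [[a1 a2 a3] [Ow1 Ow2 Ow3] sA -> hA]]]]]]].
move=> [B1 [B2 [B3 [z1 [z2 [z3 [[b1 b2 b3] [Oz1 Oz2 Oz3] sB -> hB]]]]]]] V.
set c := 1 - lam * (A1 + A2 + A3) - lam * (B1 + B2 + B3).
have c0 : 0 < c.
  rewrite /c -addrA -opprD subr_gt0 (splitr 1) div1r ltrD//.
    exact: le_lt_trans (ler_wpM2l lam0 sA) l1.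
  exact: le_lt_trans (ler_wpM2l lam0 sB) l2.
have VE : V = c *: u + (lam * A1) *: w1 + (lam * A2) *: w2 + (lam * A3) *: w3
    + (lam * B1) *: z1 + (lam * B2) *: z2 + (lam * B3) *: z3.
  by rewrite /V /c; apply/rowP => i; rewrite !mxE; ring.
(* Admissibility comes first, since the tangent inequality at [V] requires it. *)
clearbody V; have OV : Omega_a V.
  by rewrite VE; do 6 ?[apply: Omega_a_add => //; last exact: mulr_ge0];
    exact: Omega_a_scale.
split=> //.
have T w : Omega_a w -> eta M V + dotv (eta' M V) (w - V) <= eta M w.
  exact: eta_ge_tangent.
(* [V] is the barycentre, so the linear terms of the tangent inequalities cancel. *)
have sum0 : c * dotv (eta' M V) (u - V)
  + (lam * A1) * dotv (eta' M V) (w1 - V) + (lam * A2) * dotv (eta' M V) (w2 - V)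
  + (lam * A3) * dotv (eta' M V) (w3 - V) + (lam * B1) * dotv (eta' M V) (z1 - V)
  + (lam * B2) * dotv (eta' M V) (z2 - V) + (lam * B3) * dotv (eta' M V) (z3 - V) = 0.
  rewrite !dotvBr; have := congr1 (dotv (eta' M V)) VE; rewrite !dotvDr !dotvZr.
  set x := dotv _ V => xE.
  rewrite [LHS](_ : _ = c * dotv (eta' M V) u + lam * A1 * dotv (eta' M V) w1
    + lam * A2 * dotv (eta' M V) w2 + lam * A3 * dotv (eta' M V) w3
    + lam * B1 * dotv (eta' M V) z1 + lam * B2 * dotv (eta' M V) z2
    + lam * B3 * dotv (eta' M V) z3 - x); first by rewrite -xE subrr.
  by rewrite /c; ring.
have := ler_wpM2l (ltW c0) (T u Ou).
have := ler_wpM2l (mulr_ge0 lam0 a1) (T w1 Ow1).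
have := ler_wpM2l (mulr_ge0 lam0 a2) (T w2 Ow2).
have := ler_wpM2l (mulr_ge0 lam0 a3) (T w3 Ow3).
have := ler_wpM2l (mulr_ge0 lam0 b1) (T z1 Oz1).
have := ler_wpM2l (mulr_ge0 lam0 b2) (T z2 Oz2).
have := ler_wpM2l (mulr_ge0 lam0 b3) (T z3 Oz3).
have := ler_wpM2l lam0 hA; have := ler_wpM2l lam0 hB.
move: sum0.
move: (dotv _ (u - V)) (dotv _ (w1 - V)) (dotv _ (w2 - V)) (dotv _ (w3 - V))
  (dotv _ (z1 - V)) (dotv _ (z2 - V)) (dotv _ (z3 - V)) (eta M V) (eta M u)
  (eta M w1) (eta M w2) (eta M w3) (eta M z1) (eta M z2) (eta M z3).
move=> t0 t1 t2 t3 t4 t5 t6 eV eu f1 f2 f3 g1 g2 g3.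
by rewrite /c; clear lam0 l1 l2 a1 a2 a3 b1 b2 b3 sA sB hA hB c0 VE OV T; lra.
Qed.

Context (gamma : R) (hgamma : gam_max M < gamma).
Context (n : 'rV[R]_d) (hn : dotv n n = 1).

Lemma dotv_entropy_flux u : dotv (entropy_flux M u) n = - (rho u * un n u) * entropy_s M u.
Proof. by rewrite /entropy_flux dotvZl -/(un n u); ring. Qed.

Lemma rho_flux u : rho (flux M u n) = rho u * un n u.
Proof. by rewrite mkvecK. Qed.

Lemma mass_jump (p q s : R) u w :
  flux_with_pressure p u n - flux_with_pressure q w n = s *: (u - w) ->
  rho u * un n u - rho w * un n w = s * (rho u - rho w).
Proof. by move/(congr1 (@rho _ _ _)); rewrite !(rhoB, rhoZ) !mkvecK. Qed.

Lemma rho_fan (f u0 u1 u2 u3 : state R m d) (a b c : R) :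
  rho (f + a *: (u1 - u0) + b *: (u2 - u1) + c *: (u3 - u2)) =
  rho f + a * (rho u1 - rho u0) + b * (rho u2 - rho u1) + c * (rho u3 - rho u2).
Proof. by rewrite !(rhoB, rhoZ, rhoD). Qed.

Section TwoStates.
Variables uL uR : state R m d.
Hypotheses (OL : Omega_a uL) (OR : Omega_a uR).

Notation h := (num_flux M gamma uL uR n).
Notation Q := (num_entropy_flux M gamma uL uR n).
Notation sL := (SL M gamma n uL uR).
Notation sR := (SR M gamma n uL uR).
Notation us := (ustar M gamma n uL uR).
Notation w1 := (uLstar M gamma n uL uR).
Notation w2 := (uRstar M gamma n uL uR).
Notation aL := (aL M gamma n uL uR).
Notation aR := (aR M gamma n uL uR).

Let mass_left : rho w1 * us - rho uL * un n uL = sL * (rho w1 - rho uL).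
Proof.
have [[_ _ u1 jL _] _] := star_statesP hCv hgam hgamma hn OL OR.
by rewrite -{1}u1; exact: mass_jump jL.
Qed.

Let mass_right : rho uR * un n uR - rho w2 * us = sR * (rho uR - rho w2).
Proof.
have [_ [_ _ u2 jR _]] := star_statesP hCv hgam hgamma hn OL OR.
by rewrite -{1}u2; exact: mass_jump jR.
Qed.

Let mass_min : rho h = rho uL * un n uL + Num.min sL 0 * (rho w1 - rho uL)
  + Num.min us 0 * (rho w2 - rho w1) + Num.min sR 0 * (rho uR - rho w2).
Proof.
have -> := num_flux_minE hCv hgam hgamma hn OL OR.
by rewrite -rho_flux; exact: rho_fan.
Qed.

Let mass_max : rho h = rho uR * un n uR - Num.max sL 0 * (rho w1 - rho uL)
  - Num.max us 0 * (rho w2 - rho w1) - Num.max sR 0 * (rho uR - rho w2).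
Proof.
have -> := num_flux_maxE hCv hgam hgamma hn OL OR.
by rewrite -!mulNr -!scaleNr -rho_flux; exact: rho_fan.
Qed.

Lemma entropy_fan_left : entropy_fan uL (`|un n uL| + aL / rho uL)
  (flux M uL n - h) (dotv (entropy_flux M uL) n - Q).
Proof.
have [[Ow1 e1 _ _ sLu] [Ow2 e2 _ _ usR]] := star_statesP hCv hgam hgamma hn OL OR.
have aL0 := aL_gt0 hCv hgam hgamma n OL OR.
have [_ rL0 _] := OL.
(* The weights are the lengths, within [xi < 0], of the intervals where the Riemann solution equals
   [w1], [w2] and [uR]. *)
exists (Num.min us 0 - Num.min sL 0), (Num.min sR 0 - Num.min us 0),
  (- Num.min sR 0), w1, w2, uR; split=> //.
- by rewrite !subr_ge0 !min0_le// oppr_ge0 ge_min lexx orbT.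
- rewrite [leLHS](_ : _ = - Num.min sL 0); last by ring.
  by rewrite oppr_min0_le// divr_ge0// ltW.
- rewrite (num_flux_minE hCv hgam hgamma hn OL OR).
  move: (flux M uL n) w1 w2 => f z1 z2; apply/rowP => i; rewrite !mxE; ring.
- rewrite dotv_entropy_flux.
  by have := fan_entropy_left sLu usR e1 e2 mass_left mass_min.
Qed.

Lemma entropy_fan_right : entropy_fan uR (`|un n uR| + aR / rho uR)
  (h - flux M uR n) (Q - dotv (entropy_flux M uR) n).
Proof.
have [[Ow1 e1 _ _ sLu] [Ow2 e2 _ _ usR]] := star_statesP hCv hgam hgamma hn OL OR.
have aR0 := aR_gt0 hCv hgam hgamma n OL OR.
have [_ rR0 _] := OR.
(* The lengths, within [xi > 0], of the intervals occupied by [uL], [w1] and [w2]. *)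
exists (Num.max sL 0), (Num.max us 0 - Num.max sL 0),
  (Num.max sR 0 - Num.max us 0), uL, w1, w2; split=> //.
- by rewrite !subr_ge0 !max0_le// le_max lexx orbT.
- rewrite [leLHS](_ : _ = Num.max sR 0); last by ring.
  by rewrite max0_le_normD// divr_ge0// ltW.
- rewrite (num_flux_maxE hCv hgam hgamma hn OL OR).
  move: (flux M uR n) w1 w2 => f z1 z2; apply/rowP => i; rewrite !mxE; ring.
- rewrite dotv_entropy_flux.
  by have := fan_entropy_right sLu usR e1 e2 mass_right mass_max.
Qed.

End TwoStates.
End EntropyFan.

(** * Local Lipschitz continuity *)

Section LocalLipschitz.
Context {R : realType} {V : normedModType R}.
Variables (A : set V) (x0 : V).
Implicit Types (f g : V -> R) (W : normedModType R).

(** Lipschitz continuity on [A] near the single point [x0]; the explicit radius and constant allow a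
    calculus of closure rules. *)
Definition llip W (f : V -> W) := exists e k : R, [/\ 0 < e, 0 <= k &
  forall x y, A x -> A y -> `|x - x0| < e -> `|y - x0| < e ->
    `|f x - f y| <= k * `|x - y|].

Lemma llip_ext W (f g : V -> W) : (forall x, A x -> f x = g x) -> llip f -> llip g.
Proof.
move=> fg [e [k [e0 k0 h]]]; exists e, k; split=> // x y Ax Ay xe ye.
by rewrite -!fg//; exact: h.
Qed.

Lemma llip_cst (c : R) : llip (fun=> c).
Proof. by exists 1, 0; split=> // *; rewrite subrr normr0 mul0r. Qed.

Lemma llip_near2 W1 W2 (f : V -> W1) (g : V -> W2) : llip f -> llip g ->
  exists e k l : R, [/\ 0 < e, 0 <= k, 0 <= l &
    forall x y, A x -> A y -> `|x - x0| < e -> `|y - x0| < e ->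
      `|f x - f y| <= k * `|x - y| /\ `|g x - g y| <= l * `|x - y|].
Proof.
move=> [e1 [k [e10 k0 h1]]] [e2 [l [e20 l0 h2]]].
exists (Num.min e1 e2), k, l; split=> //; first by rewrite lt_min e10.
by move=> x y Ax Ay; rewrite !lt_min => /andP[? ?] /andP[? ?]; split; auto.
Qed.

Lemma llipD f g : llip f -> llip g -> llip (fun x => f x + g x).
Proof.
move=> hf hg; have [e [k [l [e0 k0 l0 h]]]] := llip_near2 hf hg.
exists e, (k + l); split=> //; first exact: addr_ge0.
move=> x y Ax Ay xe ye; have [h1 h2] := h x y Ax Ay xe ye.
by rewrite opprD addrACA mulrDl (le_trans (ler_normD _ _))// lerD.
Qed.

Lemma llipN f : llip f -> llip (fun x => - f x).
Proof.
move=> [e [k [e0 k0 h]]]; exists e, k; split=> // x y Ax Ay xe ye.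
by rewrite -opprD normrN; exact: h.
Qed.

Lemma llipB f g : llip f -> llip g -> llip (fun x => f x - g x).
Proof. by move=> hf hg; apply: llipD => //; exact: llipN. Qed.

Lemma llip_max f g : llip f -> llip g -> llip (fun x => Num.max (f x) (g x)).
Proof.
move=> hf hg; have [e [k [l [e0 k0 l0 h]]]] := llip_near2 hf hg.
exists e, (k + l); split=> //; first exact: addr_ge0.
move=> x y Ax Ay xe ye; have [h1 h2] := h x y Ax Ay xe ye.
rewrite mulrDl; move: h1 h2; move: (k * _) (l * _) => p q h1 h2.
have half (a b c d : R) : `|a - b| <= p -> `|c - d| <= q ->
    Num.max a c <= Num.max b d + (p + q).
  move=> ab cd; have p0 := le_trans (normr_ge0 _) ab.
  have q0 := le_trans (normr_ge0 _) cd.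
  have := le_trans (ler_norm _) ab; have := le_trans (ler_norm _) cd.
  have : b <= Num.max b d /\ d <= Num.max b d by rewrite !le_max !lexx orbT.
  by move: (Num.max b d) => M [bM dM] ? ?; rewrite ge_max; apply/andP; split; lra.
have := half _ _ _ _ h1 h2; rewrite distrC in h1; rewrite distrC in h2.
by have := half _ _ _ _ h1 h2; rewrite ler_norml; move: (Num.max _ _) (Num.max _ _) =>
  M N MN NM; apply/andP; split; lra.
Qed.

Lemma llip_min f g : llip f -> llip g -> llip (fun x => Num.min (f x) (g x)).
Proof.
move=> hf hg; apply: (@llip_ext _ (fun x => - Num.max (- f x) (- g x))).
  by move=> x _; rewrite oppr_max !opprK.
by apply: llipN; apply: llip_max; exact: llipN.
Qed.

Hypothesis Ax0 : A x0.

(** Controls the values as well as their differences: [dlt = 1] bounds the factors of a product, and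
    half the size of [f x0] keeps inverses and square roots away from 0. *)
Lemma llip_near_val f (dlt : R) : 0 < dlt -> llip f ->
  exists e k : R, [/\ 0 < e, 0 <= k & forall x y, A x -> A y ->
    `|x - x0| < e -> `|y - x0| < e ->
    [/\ `|f x - f y| <= k * `|x - y|, `|f x - f x0| <= dlt & `|f y - f x0| <= dlt]].
Proof.
move=> d0 [e [k [e0 k0 h]]]; have k1 : 0 < k + 1 by lra.
(* [k + 1] replaces [k], which may be zero, in the denominator. *)
exists (Num.min e (dlt / (k + 1))), k; split=> //.
  by rewrite lt_min e0 divr_gt0.
have near x : A x -> `|x - x0| < e -> `|x - x0| < dlt / (k + 1) ->
    `|f x - f x0| <= dlt.
  move=> Ax xe xd; have := h x x0 Ax Ax0 xe; rewrite subrr normr0 => /(_ e0).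
  move/le_trans; apply; have : k * `|x - x0| <= (k + 1) * `|x - x0|.
    by rewrite ler_wpM2r//; lra.
  by move/le_trans; apply; rewrite mulrC -ler_pdivlMr// ltW.
by move=> x y Ax Ay; rewrite !lt_min => /andP[? ?] /andP[? ?]; split; auto.
Qed.

Lemma llipM f g : llip f -> llip g -> llip (fun x => f x * g x).
Proof.
move=> /(llip_near_val ltr01)[e1 [k [e10 k0 hf]]].
move=> /(llip_near_val ltr01)[e2 [l [e20 l0 hg]]].
exists (Num.min e1 e2), ((`|f x0| + 1) * l + (`|g x0| + 1) * k); split.
- by rewrite lt_min e10.
- by rewrite addr_ge0// mulr_ge0// addr_ge0.
move=> x y Ax Ay; rewrite !lt_min => /andP[x1 x2] /andP[y1 y2].
have [fxy fx _] := hf x y Ax Ay x1 y1; have [gxy _ gy] := hg x y Ax Ay x2 y2.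
have bnd (u v : R) : `|u - v| <= 1 -> `|u| <= `|v| + 1.
  move=> uv; rewrite -(subrK v u) addrC (le_trans (ler_normD _ _))//.
  by rewrite lerD2l.
have -> : f x * g x - f y * g y = f x * (g x - g y) + g y * (f x - f y) by ring.
rewrite (le_trans (ler_normD _ _))// mulrDl !normrM -!mulrA lerD//.
  by rewrite ler_pM// bnd.
by rewrite ler_pM// bnd.
Qed.

Lemma llipV f : f x0 != 0 -> llip f -> llip (fun x => (f x)^-1).
Proof.
move=> fx0; have b0 : 0 < `|f x0| / 2 by rewrite divr_gt0// normr_gt0.
move=> /(llip_near_val b0)[e [k [e0 k0 h]]].
set b := `|f x0| / 2 in b0 h.
exists e, (k / (b * b)); split=> //; first by rewrite divr_ge0// mulr_ge0// ltW.
move=> x y Ax Ay xe ye; have [fxy fx fy] := h x y Ax Ay xe ye.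
have lb (u : R) : `|u - f x0| <= b -> b <= `|u|.
  move=> ub; have := ler_normD (f x0 - u) u; rewrite subrK distrC.
  by rewrite /b in ub *; lra.
have bx := lb _ fx; have by_ := lb _ fy.
have x1 : f x != 0 by rewrite -normr_gt0 (lt_le_trans b0).
have y1 : f y != 0 by rewrite -normr_gt0 (lt_le_trans b0).
have -> : (f x)^-1 - (f y)^-1 = (f y - f x) / (f x * f y).
  by field; rewrite x1 y1.
rewrite normrM distrC normfV normrM mulrAC ler_pM// ?invr_ge0 ?mulr_ge0//.
by rewrite lef_pV2 ?posrE ?mulr_gt0 ?normr_gt0// ler_pM// ltW.
Qed.

Lemma llip_sqrt f : 0 < f x0 -> llip f -> llip (fun x => Num.sqrt (f x)).
Proof.
move=> fx0; have b0 : 0 < f x0 / 2 by rewrite divr_gt0.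
move=> /(llip_near_val b0)[e [k [e0 k0 h]]].
set b := f x0 / 2 in b0 h.
have sb : 0 < Num.sqrt b by rewrite sqrtr_gt0.
exists e, (k / Num.sqrt b); split=> //; first by rewrite divr_ge0// ltW.
move=> x y Ax Ay xe ye; have [fxy fx fy] := h x y Ax Ay xe ye.
have lb (u : R) : `|u - f x0| <= b -> b <= u.
  by rewrite ler_norml /b => /andP[+ _]; lra.
have bx := lb _ fx; have by_ := lb _ fy.
have fx1 := le_trans (ltW b0) bx; have fy1 := le_trans (ltW b0) by_.
rewrite mulrAC ler_pdivlMr//; apply: le_trans fxy.
have -> : f x - f y = (Num.sqrt (f x) - Num.sqrt (f y))
    * (Num.sqrt (f x) + Num.sqrt (f y)).
  by rewrite -subr_sqr !sqr_sqrtr.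
rewrite normrM ler_wpM2l// ger0_norm ?addr_ge0 ?sqrtr_ge0//.
by rewrite (@le_trans _ _ (Num.sqrt (f x)))// ?ler_sqrt// lerDl sqrtr_ge0.
Qed.

Lemma llip_sum (I : Type) (r : seq I) (F : I -> V -> R) :
  (forall i, llip (F i)) -> llip (fun x => \sum_(i <- r) F i x).
Proof.
move=> hF; elim: r => [|i r IH].
  by apply: (@llip_ext _ (fun=> 0)); [move=> x _; rewrite big_nil|exact: llip_cst].
apply: (@llip_ext _ (fun x => F i x + \sum_(j <- r) F j x)).
  by move=> x _; rewrite big_cons.
exact: llipD.
Qed.

Lemma llip_row (N : nat) (F : V -> 'rV[R]_N) :
  (forall i, llip (fun x => F x 0 i)) -> llip F.
Proof.
move=> /choice[e] /choice[k] h.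
(* The seed 1 keeps the radius positive even for an empty row. *)
exists (\big[Num.min/1]_i e i), (\sum_i k i); split.
- by apply: lt_bigmin => // i _; case: (h i).
- by apply: sumr_ge0 => i _; case: (h i).
move=> x y Ax Ay xe ye.
rewrite [leLHS]/Num.norm/= mx_normrE; apply: bigmax_le.
  by rewrite mulr_ge0// sumr_ge0// => i _; case: (h i).
move=> [i0 i] _ /=; rewrite !ord1 !mxE; have [_ _ hi] := h i.
have ei z : `|z - x0| < \big[Num.min/1]_i e i -> `|z - x0| < e i.
  by move/lt_le_trans; apply; exact: bigmin_le.
apply: le_trans (hi x y Ax Ay (ei _ xe) (ei _ ye)) _.
rewrite ler_wpM2r// (bigD1 i)//= lerDl sumr_ge0// => j _; by case: (h j).
Qed.

End LocalLipschitz.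

(* Off the diagonal the quotient |f x - f y| / |x - y| is bounded because f is
   locally bounded and |x - y| stays away from 0. *)
Lemma locally_lipschitzP (R : realType) (V W : normedModType R) (A : set V)
    (f : V -> W) :
  (forall x0, A x0 -> llip A x0 f) -> [locally [lipschitz f x | x in A]].
Proof.
move=> hf; move=> [x0 y0] [/= Ax0 Ay0].
suff [k hk] : exists k : R, \forall z \near (x0, y0), A z.1 -> A z.2 ->
    `|f z.1 - f z.2| <= k * `|z.1 - z.2|.
  exists k; split; first exact: num_real.
  move=> M kM; rewrite /dominated_by /within/=; apply: filterS hk => z hz [Az1 Az2].
  apply: le_trans (hz Az1 Az2) _; rewrite ler_wpM2r//; exact: ltW.
have nearP e1 e2 : 0 < e1 -> 0 < e2 ->
    \forall z \near (x0, y0), `|z.1 - x0| < e1 /\ `|z.2 - y0| < e2.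
  move=> e10 e20; exists (ball x0 e1, ball y0 e2) => /=.
    by split; exact: nbhsx_ballx.
  by move=> [z1 z2] /= [+ +]; rewrite -!ball_normE/= !(distrC _ z1) (distrC _ z2).
have [e1 [k1 [e10 k10 h1]]] := hf x0 Ax0.
have [xy|xy] := eqVneq x0 y0.
  exists k1; apply: filterS (nearP _ _ e10 e10) => z [z1 z2] Az1 Az2.
  by apply: h1 => //; rewrite xy.
have [e2 [k2 [e20 k20 h2]]] := hf y0 Ay0.
(* Moving each point by less than [dl] leaves at least half of the distance [4 dl], so [x] and [y]
   stay more than [dl] apart. *)
set dl := `|x0 - y0| / 4; have d0 : 0 < dl.
  by rewrite divr_gt0// normr_gt0 subr_eq0.
set m1 := Num.min e1 dl; set m2 := Num.min e2 dl.
have m10 : 0 < m1 by rewrite lt_min e10.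
have m20 : 0 < m2 by rewrite lt_min e20.
exists ((k1 * dl + `|f x0 - f y0| + k2 * dl) / dl).
apply: filterS (nearP _ _ m10 m20) => -[x y] /=; rewrite !lt_min.
move=> [/andP[x1 x2] /andP[y1 y2]] Ax Ay.
have a1 : `|f x - f x0| <= k1 * dl.
  apply: le_trans (h1 x x0 Ax Ax0 x1 _) _; first by rewrite subrr normr0.
  by rewrite ler_wpM2l// ltW.
have a2 : `|f y - f y0| <= k2 * dl.
  apply: le_trans (h2 y y0 Ay Ay0 y1 _) _; first by rewrite subrr normr0.
  by rewrite ler_wpM2l// ltW.
have dxy : dl <= `|x - y|.
  have := ler_normD (x0 - x) (x - y0); rewrite addrA subrK.
  have := ler_normD (x - y) (y - y0); rewrite addrA subrK.
  rewrite (distrC x0 x); move: x2 y2 (normr_ge0 (x0 - y0)); rewrite /dl.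
  by move: `|x - x0| `|y - y0| `|x0 - y0| `|x - y| `|x - y0| => *; lra.
have -> : f x - f y = (f x - f x0) + (f x0 - f y0) + - (f y - f y0).
  by rewrite opprB !subrKA.
set K := k1 * dl + _ + _.
have K0 : 0 <= K by rewrite !addr_ge0// mulr_ge0// ltW.
apply: (@le_trans _ _ K).
  apply: le_trans (ler_normD _ _) _; rewrite normrN lerD//.
  by apply: le_trans (ler_normD _ _) _; rewrite lerD.
by rewrite mulrAC ler_pdivlMr// ler_wpM2l.
Qed.

(** * Lipschitz dependence of the numerical flux on the two states *)

Section LipschitzState.
Context {R : realType} {m d : nat} {M : mixture R m}.
Context (hCv : forall i, 0 < Cv M i) (hgam : forall i, 1 < gam M i).
Context {V : normedModType R} (A : set V) (x0 : V) (Ax0 : A x0).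

Notation llip := (llip A x0).

Lemma llip_mkvec (Y : V -> 'rV[R]_m) (r : V -> R) (q : V -> 'rV[R]_d) (E : V -> R) :
  (forall i, llip (fun x => Y x 0 i)) -> llip r ->
  (forall i, llip (fun x => q x 0 i)) -> llip E ->
  forall j, llip (fun x => mkvec (Y x) (r x) (q x) (E x) 0 j).
Proof.
move=> hY hr hq hE j; rewrite /mkvec.
case: (split_ordP j) => {}j ->.
  by apply: llip_ext (hY j) => x _; rewrite row_mxEl.
case: (split_ordP j) => {}j ->.
  by apply: llip_ext hr => x _; rewrite row_mxEr row_mxEl mxE ord1 eqxx.
case: (split_ordP j) => {}j ->.
  by apply: llip_ext (hq j) => x _; rewrite !row_mxEr row_mxEl.
by apply: llip_ext hE => x _; rewrite !row_mxEr mxE !ord1 eqxx.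
Qed.

Section OneState.
Variable u : V -> state R m d.
Hypotheses (hu : forall j, llip (fun x => u x 0 j)) (Ou : forall x, A x -> Omega_a (u x)).
Context (gamma : R) (gamma1 : 1 < gamma) (n : 'rV[R]_d).

Let rn x : A x -> rho (u x) != 0.
Proof. by move=> /Ou[_ /lt0r_neq0]. Qed.

Lemma llip_rho : llip (fun x => rho (u x)).
Proof.
apply: llip_ext (hu (rshift m (lshift (d + 1) 0))) => x _.
by rewrite /rho !mxE.
Qed.
Let h1 := llip_rho.

Lemma llip_rhoVr : llip (fun x => (rho (u x))^-1).
Proof. by apply: llipV => //; exact: rn. Qed.
Let h1V := llip_rhoVr.

Lemma llip_rhoY i : llip (fun x => rhoY (u x) 0 i).
Proof. by apply: llip_ext (hu (lshift _ i)) => x _; rewrite !mxE. Qed.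

Lemma llip_rhov i : llip (fun x => rhov (u x) 0 i).
Proof.
by apply: llip_ext (hu (rshift m (rshift 1 (lshift 1 i)))) => x _; rewrite !mxE.
Qed.

Lemma llip_rhoE : llip (fun x => rhoE (u x)).
Proof.
apply: llip_ext (hu (rshift m (rshift 1 (rshift d 0)))) => x _.
by rewrite /rhoE !mxE.
Qed.
Let h2 := llip_rhoE.

Lemma llip_fracs i : llip (fun x => fracs (u x) 0 i).
Proof.
apply: (@llip_ext _ _ _ _ _ (fun x => (rho (u x))^-1 * rhoY (u x) 0 i)).
  by move=> x _; rewrite [RHS]mxE.
by apply: llipM => //; exact: llip_rhoY.
Qed.
Let hfracs := llip_fracs.

Lemma llip_vel i : llip (fun x => vel (u x) 0 i).
Proof.
apply: (@llip_ext _ _ _ _ _ (fun x => (rho (u x))^-1 * rhov (u x) 0 i)).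
  by move=> x _; rewrite [RHS]mxE.
by apply: llipM => //; exact: llip_rhov.
Qed.
Let hvel := llip_vel.

Lemma llip_un : llip (fun x => un n (u x)).
Proof. by rewrite /un /dotv; apply: llip_sum => i; apply: llipM => //; exact: llip_cst. Qed.
Let hun := llip_un.

Lemma llip_Etot : llip (fun x => Etot (u x)).
Proof. by rewrite /Etot; apply: llipM. Qed.
Let hEtot := llip_Etot.

Lemma llip_eint : llip (fun x => eint (u x)).
Proof.
rewrite /eint; apply: llipB => //; apply: llipM => //; last exact: llip_cst.
by apply: llip_sum => i; apply: llipM.
Qed.
Let heint := llip_eint.

Lemma llip_mix (c : 'I_m.+1 -> R) :
  llip (fun x => \sum_i massfrac (fracs (u x)) i * c i).
Proof.
apply: llip_sum => i; apply: llipM => //; last exact: llip_cst.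
rewrite /massfrac; case: (unlift _ _) => [j|]; first exact: hfracs.
by apply: llipB; [exact: llip_cst|apply: llip_sum => j; exact: hfracs].
Qed.

Lemma llip_pres : llip (fun x => pres M (u x)).
Proof.
rewrite /pres /pressure /gammix; do 2 apply: llipM => //.
apply: llipB; last exact: llip_cst.
apply: llipM => //; first exact: llip_mix.
apply: llipV => //; last exact: llip_mix.
by apply/lt0r_neq0/Cvmix_gt0; first exact: hCv; exact: Ou.
Qed.
Let hpres := llip_pres.

Lemma llip_c_gamma : llip (fun x => c_gamma gamma (rho (u x)) (pres M (u x))).
Proof.
rewrite /c_gamma; apply: llip_sqrt => //.
  have O0 := Ou Ax0; have [_ r0 _] := O0.
  by rewrite divr_gt0// mulr_gt0 ?pres_gt0// (lt_trans ltr01).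
by apply: llipM => //; apply: llipM => //; exact: llip_cst.
Qed.

Lemma llip_flux j : llip (fun x => flux M (u x) n 0 j).
Proof.
apply: llip_mkvec => [i||i|].
- apply: (@llip_ext _ _ _ _ _ (fun x => un n (u x) * rhoY (u x) 0 i)).
    by move=> x _; rewrite [RHS]mxE.
  by apply: llipM => //; exact: llip_rhoY.
- exact: llipM.
- apply: (@llip_ext _ _ _ _ _ (fun x => rho (u x) * un n (u x) * vel (u x) 0 i
    + pres M (u x) * n 0 i)).
    by move=> x _; rewrite [RHS]mxE; congr (_ + _); rewrite [RHS]mxE.
  by apply: llipD; do ?apply: llipM => //; exact: llip_cst.
- by apply: llipM => //; exact: llipD.
Qed.

Lemma llip_star_state (r E dv : V -> R) j : llip r -> llip E -> llip dv ->
  llip (fun x => (mkvec (r x *: fracs (u x)) (r x) (r x *: (vel (u x) + dv x *: n))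
                   (r x * E x) : state R m d) 0 j).
Proof.
move=> hr hE hdv; apply: llip_mkvec => [i||i|] //.
- apply: (@llip_ext _ _ _ _ _ (fun x => r x * fracs (u x) 0 i)).
    by move=> x _; rewrite [RHS]mxE.
  exact: llipM.
- apply: (@llip_ext _ _ _ _ _ (fun x => r x * (vel (u x) 0 i + dv x * n 0 i))).
    by move=> x _; rewrite [RHS]mxE; congr (_ * _); rewrite [RHS]mxE;
      congr (_ + _); rewrite [RHS]mxE.
  by apply: llipM => //; apply: llipD => //; apply: llipM => //; exact: llip_cst.
- exact: llipM.
Qed.

End OneState.

Section TwoStates.
Variables uL uR : V -> state R m d.
Hypotheses (huL : forall j, llip (fun x => uL x 0 j))
  (huR : forall j, llip (fun x => uR x 0 j)).
Hypotheses (OL : forall x, A x -> Omega_a (uL x))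
  (OR : forall x, A x -> Omega_a (uR x)).
Context (gamma : R) (hgamma : gam_max M < gamma).
Context (n : 'rV[R]_d) (hn : dotv n n = 1).

Let gamma1 : 1 < gamma. Proof. exact: (gamma_gt1 hgam hgamma). Qed.

Local Notation cL x := (c_gamma gamma (rho (uL x)) (pres M (uL x))).
Local Notation cR x := (c_gamma gamma (rho (uR x)) (pres M (uR x))).
Local Notation pL x := (pres M (uL x)).
Local Notation pR x := (pres M (uR x)).
Local Notation vL x := (un n (uL x)).
Local Notation vR x := (un n (uR x)).
Local Notation rL x := (rho (uL x)).
Local Notation rR x := (rho (uR x)).
Local Notation al := ((gamma + 1) / 2).

(* The speeds predicted with the sound speed of the opposite state. Their
   positive parts merge the two cases of [lagrangian_speeds] in one formula. *)
Let aL1 x := rL x * (cL x + al * pos (pos (pR x - pL x) / (rR x * cR x) + vL x - vR x)).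
Let aR1 x := rR x * (cR x + al * pos (pos (pL x - pR x) / (rL x * cL x) + vL x - vR x)).

Let aLE x : A x -> rL x * (cL x + al *
    pos (pos (pR x - pL x) / (rR x * cR x) - pos (pL x - pR x) / aR1 x
         + vL x - vR x)) = aL M gamma n (uL x) (uR x).
Proof.
move=> Ax; rewrite /aL /lagrangian_speeds /aR1; case: leP => pp /=.
  rewrite (_ : pos (pL x - pR x) = 0) ?mul0r ?subr0; last first.
    by rewrite /pos max_r// subr_le0.
  by rewrite (_ : pos (pR x - pL x) = pR x - pL x)// /pos max_l// subr_ge0.
rewrite (_ : pos (pR x - pL x) = 0) ?mul0r ?sub0r; last first.
  by rewrite /pos max_r// subr_le0 ltW.
rewrite (_ : pos (pL x - pR x) = pL x - pR x); last first.
  by rewrite /pos max_l// subr_ge0 ltW.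
by rewrite -mulNr opprB.
Qed.

Let aRE x : A x -> rR x * (cR x + al *
    pos (pos (pL x - pR x) / (rL x * cL x) - pos (pR x - pL x) / aL1 x
         + vL x - vR x)) = aR M gamma n (uL x) (uR x).
Proof.
move=> Ax; rewrite /aR /lagrangian_speeds /aL1; case: leP => pp /=.
  rewrite (_ : pos (pL x - pR x) = 0) ?mul0r ?sub0r; last first.
    by rewrite /pos max_r// subr_le0.
  rewrite (_ : pos (pR x - pL x) = pR x - pL x); last first.
    by rewrite /pos max_l// subr_ge0.
  by rewrite -mulNr opprB.
rewrite (_ : pos (pR x - pL x) = 0) ?mul0r ?subr0; last first.
  by rewrite /pos max_r// subr_le0 ltW.
by rewrite (_ : pos (pL x - pR x) = pL x - pR x)// /pos max_l// subr_ge0 ltW.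
Qed.

Let llip_pos f : llip f -> llip (fun x => pos (f x)).
Proof. by move=> hf; apply: llip_max => //; exact: llip_cst. Qed.

Let hrL := llip_rho huL.
Let hrR := llip_rho huR.
Let hcL := llip_c_gamma huL OL gamma1.
Let hcR := llip_c_gamma huR OR gamma1.
Let hpL := llip_pres huL OL.
Let hpR := llip_pres huR OR.
Let hvL := llip_un huL OL n.
Let hvR := llip_un huR OR n.

Let rL0 : 0 < rL x0. Proof. by case: (OL Ax0). Qed.
Let rR0 : 0 < rR x0. Proof. by case: (OR Ax0). Qed.
Let cL0 : 0 < cL x0. Proof. exact: (c_gamma_gt0 hCv hgam hgamma (OL Ax0)). Qed.
Let cR0 : 0 < cR x0. Proof. exact: (c_gamma_gt0 hCv hgam hgamma (OR Ax0)). Qed.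

Let speed_gt0 (r c X : R) : 0 < r -> 0 < c -> r * (c + al * pos X) != 0.
Proof.
move=> r0 c0; apply/lt0r_neq0/mulr_gt0 => //; rewrite ltr_pwDl//.
by rewrite mulr_ge0 ?pos_ge0//; have := gamma1; lra.
Qed.

Let llip_speed (r c X : V -> R) : llip r -> llip c -> llip X ->
  llip (fun x => r x * (c x + al * pos (X x))).
Proof.
move=> hr hc hX; apply: llipM => //; apply: llipD => //.
by apply: llipM => //; [exact: llip_cst|exact: llip_pos].
Qed.

Let haL : llip (fun x => aL M gamma n (uL x) (uR x)).
Proof.
apply: llip_ext aLE _; apply: llip_speed => //.
apply: llipB => //; apply: llipD => //; apply: llipB; apply: llipM => //.
- by apply: llip_pos; exact: llipB.
- by apply: llipV => //; [rewrite mulf_neq0// lt0r_neq0|exact: llipM].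
- by apply: llip_pos; exact: llipB.
- apply: llipV => //; first exact: speed_gt0.
  apply: llip_speed => //; apply: llipB => //; apply: llipD => //; apply: llipM => //.
    by apply: llip_pos; exact: llipB.
  by apply: llipV => //; [rewrite mulf_neq0// lt0r_neq0|exact: llipM].
Qed.

Let haR : llip (fun x => aR M gamma n (uL x) (uR x)).
Proof.
apply: llip_ext aRE _; apply: llip_speed => //.
apply: llipB => //; apply: llipD => //; apply: llipB; apply: llipM => //.
- by apply: llip_pos; exact: llipB.
- by apply: llipV => //; [rewrite mulf_neq0// lt0r_neq0|exact: llipM].
- by apply: llip_pos; exact: llipB.
- apply: llipV => //; first exact: speed_gt0.
  apply: llip_speed => //; apply: llipB => //; apply: llipD => //; apply: llipM => //.
    by apply: llip_pos; exact: llipB.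
  by apply: llipV => //; [rewrite mulf_neq0// lt0r_neq0|exact: llipM].
Qed.

Let a0 := aL_gt0 hCv hgam hgamma n (OL Ax0) (OR Ax0).
Let b0 := aR_gt0 hCv hgam hgamma n (OL Ax0) (OR Ax0).

Let haLV : llip (fun x => (aL M gamma n (uL x) (uR x))^-1).
Proof. by apply: llipV => //; exact: lt0r_neq0. Qed.

Let haRV : llip (fun x => (aR M gamma n (uL x) (uR x))^-1).
Proof. by apply: llipV => //; exact: lt0r_neq0. Qed.

Let habV : llip (fun x => (aL M gamma n (uL x) (uR x) + aR M gamma n (uL x) (uR x))^-1).
Proof. by apply: llipV => //; [rewrite lt0r_neq0// addr_gt0|exact: llipD]. Qed.

Let hus : llip (fun x => ustar M gamma n (uL x) (uR x)).
Proof.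
apply: llipM => //; apply: llipB => //; apply: llipD => //.
by apply: llipD; exact: llipM.
Qed.

Let hps : llip (fun x => pstar M gamma n (uL x) (uR x)).
Proof.
rewrite /pstar /=.
apply: llipM => //; apply: llipD => //; first by apply: llipD; exact: llipM.
by apply: llipM => //; [exact: llipM|exact: llipB].
Qed.

Let hstar := star_statesP hCv hgam hgamma hn (OL Ax0) (OR Ax0).

Let hrLs : llip (fun x => rhoLstar M gamma n (uL x) (uR x)).
Proof.
apply: llipV => //.
  have [[[_ + _] _ _ _ _] _] := hstar.
  by rewrite rho_mkvec invr_gt0 => /lt0r_neq0.
apply: llipD; first exact: llip_rhoVr huL OL.
by apply: llipM => //; exact: llipB.
Qed.

Let hrRs : llip (fun x => rhoRstar M gamma n (uL x) (uR x)).
Proof.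
apply: llipV => //.
  have [_ [[_ + _] _ _ _ _]] := hstar.
  by rewrite rho_mkvec invr_gt0 => /lt0r_neq0.
apply: llipD; first exact: llip_rhoVr huR OR.
by apply: llipM => //; exact: llipB.
Qed.

Let hw1 j : llip (fun x => uLstar M gamma n (uL x) (uR x) 0 j).
Proof.
apply: llip_star_state => //; last exact: llipB.
apply: llipB; first exact: llip_Etot huL OL.
by apply: llipM => //; apply: llipB; exact: llipM.
Qed.

Let hw2 j : llip (fun x => uRstar M gamma n (uL x) (uR x) 0 j).
Proof.
apply: llip_star_state => //; last exact: llipB.
apply: llipB; first exact: llip_Etot huR OR.
by apply: llipM => //; apply: llipB; exact: llipM.
Qed.

Let hSL : llip (fun x => SL M gamma n (uL x) (uR x)).
Proof. by apply: llipB => //; apply: llipM => //; exact: llip_rhoVr huL OL. Qed.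

Let hSR : llip (fun x => SR M gamma n (uL x) (uR x)).
Proof. by apply: llipD => //; apply: llipM => //; exact: llip_rhoVr huR OR. Qed.

(** The formula [num_flux_minE] has no branches: it is built from sums, products and minima of
    quantities already known to be Lipschitz near [x0]. *)
Lemma llip_num_flux : llip (fun x => num_flux M gamma (uL x) (uR x) n).
Proof.
apply: llip_row => j.
apply: (@llip_ext _ _ _ _ _ (fun x => flux M (uL x) n 0 j
  + Num.min (SL M gamma n (uL x) (uR x)) 0
    * (uLstar M gamma n (uL x) (uR x) 0 j - uL x 0 j)
  + Num.min (ustar M gamma n (uL x) (uR x)) 0
    * (uRstar M gamma n (uL x) (uR x) 0 j - uLstar M gamma n (uL x) (uR x) 0 j)
  + Num.min (SR M gamma n (uL x) (uR x)) 0
    * (uR x 0 j - uRstar M gamma n (uL x) (uR x) 0 j))).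
  move=> x Ax; rewrite (num_flux_minE hCv hgam hgamma hn (OL Ax) (OR Ax)).
  move: (flux _ _ _) (uLstar _ _ _ _ _) (uRstar _ _ _ _ _) => f z1 z2.
  by rewrite !mxE.
have llip_min0 (f : V -> R) : llip f -> llip (fun x => Num.min (f x) 0).
  by move=> hf; apply: llip_min => //; exact: llip_cst.
do 3 (apply: llipD; last by apply: llipM => //; [exact: llip_min0|exact: llipB]).
exact: llip_flux.
Qed.

End TwoStates.
End LipschitzState.

(** * The scheme *)

Section Assembly.
Context {R : realType} {m d : nat} {M : mixture R m}.
Context (hCv : forall i, 0 < Cv M i) (hgam : forall i, 1 < gam M i).
Context (gamma : R) (hgamma : gam_max M < gamma).
Context (n : 'rV[R]_d) (hn : dotv n n = 1).
Implicit Types (u w : state R m d).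

Lemma num_flux_locally_lipschitz (Omega := @Omega_a R m d) :
  [locally [lipschitz (num_flux M gamma u.1 u.2 n) | u in Omega `*` Omega]].
Proof.
apply: locally_lipschitzP => u0 Au0.
have coord (p : state R m d * state R m d) j :
    `|p.1 0 j| <= `|p| /\ `|p.2 0 j| <= `|p|.
  have entry (v : state R m d) : `|v 0 j| <= `|v|.
    rewrite [leRHS]/Num.norm/= mx_normrE.
    exact: (le_bigmax _ (fun ij => `|v ij.1 ij.2|) (0, j)).
  by rewrite prod_normE !le_max !entry orbT.
apply: (llip_num_flux hCv hgam Au0 (uL := fst) (uR := snd)) => //.
- move=> j; exists 1, 1; split=> // x y _ _ _ _; rewrite mul1r.
  by have [+ _] := coord (x - y) j; rewrite !mxE.
- move=> j; exists 1, 1; split=> // x y _ _ _ _; rewrite mul1r.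
  by have [_ +] := coord (x - y) j; rewrite !mxE.
- by move=> x [].
- by move=> x [].
Qed.

(** For equal states [ustar] and [pstar] reduce to the velocity and pressure of [u], so both star
    states are [u] and all branches of [riemann] coincide. *)
Lemma num_flux_consistent u : Omega_a u -> num_flux M gamma u u n = flux M u n.
Proof.
move=> Ou; have [_ r0 _] := Ou.
have a0 := aL_gt0 hCv hgam hgamma n Ou Ou.
have b0 := aR_gt0 hCv hgam hgamma n Ou Ou.
have ab : aL M gamma n u u + aR M gamma n u u != 0 by rewrite lt0r_neq0// addr_gt0.
have us : ustar M gamma n u u = un n u by rewrite /ustar; field.
have ps : pstar M gamma n u u = pres M u by rewrite /pstar; field.
have star_id : mkvec (rho u *: fracs u) (rho u) (rho u *: vel u) (rho u * Etot u) = u.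
  have rn := lt0r_neq0 r0.
  by rewrite -rho_fracs// -rho_vel// -rho_Etot// -mkvec_eta.
have uL : uLstar M gamma n u u = u.
  rewrite /uLstar /rhoLstar /ELstar us ps !subrr !mul0r addr0 invrK scale0r.
  by rewrite addr0 subr0.
have uR : uRstar M gamma n u u = u.
  rewrite /uRstar /rhoRstar /ERstar us ps !subrr !mul0r addr0 invrK scale0r.
  by rewrite addr0 subr0.
by rewrite /num_flux /riemann uL uR ps !if_same.
Qed.

Lemma num_entropy_flux_consistent u : Omega_a u ->
  num_entropy_flux M gamma u u n = dotv (entropy_flux M u) n.
Proof.
move=> Ou; rewrite /num_entropy_flux num_flux_consistent// if_same.
by rewrite dotv_entropy_flux rho_flux.
Qed.

Lemma dotv_flux u (x : 'rV[R]_d) w : dotv (flux M u x) w =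
  (dotv (rhoY u) (rhoY w) + rho u * rho w + rho u * dotv (vel u) (rhov w)
   + (rhoE u + pres M u) * rhoE w) * dotv (vel u) x
  + pres M u * dotv (rhov w) x.
Proof.
rewrite dotv_state !mkvecK -/(un x u) !dotvDl !(dotvZl (un x u)).
by rewrite (dotvZl (rho u * un x u)) (dotvZl (pres M u)) (dotvC x); ring.
Qed.

Lemma dotv_delta k (x : 'rV[R]_d) : dotv x (delta_mx 0 k) = x 0 k.
Proof.
rewrite /dotv (bigD1 k)//= big1 ?addr0 => [|i ik]; rewrite mxE !eqxx.
  by rewrite mulr1.
by rewrite (negbTE ik) mulr0.
Qed.

(** [psi] is defined column by column; since the flux is linear in the direction, as [dotv_flux]
    displays, the columns combine into the flux along [n]. *)
Lemma dotv_psi u : dotv (psi M u) n =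
  dotv (eta' M u) (flux M u n) - dotv (entropy_flux M u) n.
Proof.
rewrite /psi dotvBl; congr (_ - _); rewrite [RHS]dotvC dotv_flux.
set a := (X in X * _ + _); rewrite {1 3 4}/dotv !mulr_sumr -big_split/=.
apply: eq_bigr => k _.
by rewrite mxE dotv_flux !dotv_delta -/a; ring.
Qed.

(** The tangent inequalities of the two halves of the fan are added; the entropy flux [Q] cancels,
    and [dotv_psi] identifies the remaining terms. *)
Lemma num_flux_Tadmor uL uR : Omega_a uL -> Omega_a uR ->
  dotv (eta' M uR - eta' M uL) (num_flux M gamma uL uR n)
  <= dotv (psi M uR - psi M uL) n.
Proof.
move=> OL OR.
have key (x y f g h : state R m d) (Q qL qR : R) :
    dotv x (f - h) <= qL - Q -> dotv y (h - g) <= Q - qR ->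
    dotv (y - x) h <= (dotv y g - qR) - (dotv x f - qL).
  by rewrite dotvBl !dotvBr; lra.
rewrite (dotvBl (psi M uR)) !dotv_psi; apply: key.
  exact: (entropy_fan_tangent hCv hgam OL
    (entropy_fan_left hCv hgam hgamma hn OL OR)).
exact: (entropy_fan_tangent hCv hgam OR
  (entropy_fan_right hCv hgam hgamma hn OL OR)).
Qed.

Lemma CFL_wave_speed (dt dx : R) (U : int -> state R m d) j : 0 < dt / dx ->
  CFL M gamma dt dx n U -> dt / dx * wave_speed M gamma n U j < 2^-1.
Proof.
move=> l0; rewrite /CFL => h; rewrite -lte_fin; apply: le_lt_trans h.
rewrite EFinM lee_pmul2l ?lte_fin//; apply: ereal_sup_ubound.
by exists j.
Qed.

Lemma scheme_step_stable (dt dx : R) (U : int -> state R m d) j :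
  0 < dt / dx -> (forall i, Omega_a (U i)) -> CFL M gamma dt dx n U ->
  let V := scheme_step M gamma dt dx n U j in
  Omega_a V /\ eta M V <= eta M (U j)
    + dt / dx * (num_entropy_flux M gamma (U (j - 1)) (U j) n
                 - num_entropy_flux M gamma (U j) (U (j + 1)) n).
Proof.
move=> l0 OU /(CFL_wave_speed j l0); rewrite /wave_speed => cfl.
have cfl1 : dt / dx * (`|un n (U j)| + aR M gamma n (U (j - 1)) (U j) / rho (U j)) < 2^-1.
  by apply: le_lt_trans cfl; rewrite ler_pM2l// le_max lexx.
have cfl2 : dt / dx * (`|un n (U j)| + aL M gamma n (U j) (U (j + 1)) / rho (U j)) < 2^-1.
  by apply: le_lt_trans cfl; rewrite ler_pM2l// le_max lexx orbT.
(* The cell receives the right half of the fan at its left interface and the left half of the fan at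
   its right interface; the two contributions of the flux of [U j] cancel. *)
have [] := entropy_fan_update hCv hgam (OU j) (ltW l0) cfl1 cfl2
  (entropy_fan_right hCv hgam hgamma hn (OU (j - 1)) (OU j))
  (entropy_fan_left hCv hgam hgamma hn (OU j) (OU (j + 1))).
rewrite addrA subrK -opprB scalerN /= -/(scheme_step M gamma dt dx n U j) => OV etaV.
split=> //; apply: le_trans etaV _; rewrite lerD2l ler_wpM2l ?(ltW l0)//; lra.
Qed.

End Assembly.

Theorem mainTheorem2 (R : realType) (m d : nat) (hm : (1 <= m)%N)
  (hd : (1 <= d)%N) (M : mixture R m)
  (hCv : forall i, 0 < Cv M i) (hgam : forall i, 1 < gam M i)
  (gamma : R) (hgamma : gam_max M < gamma)
  (n : 'rV[R]_d) (hn : dotv n n = 1)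
  (dt dx : R) (hdt : 0 < dt) (hdx : 0 < dx) :
  let Omega : set (state R m d) := @Omega_a R m d in
  let h := fun uL uR : state R m d => num_flux M gamma uL uR n in
  let Q := fun uL uR : state R m d => num_entropy_flux M gamma uL uR n in
  (forall u, Omega u -> h u u = flux M u n) /\
  [locally [lipschitz h u.1 u.2 | u in Omega `*` Omega]] /\
  ((forall u, Omega u -> Q u u = dotv (entropy_flux M u) n) /\
   (forall (U : nat -> int -> state R m d) (k : nat),
      (forall j, Omega (U k j)) ->
      CFL M gamma dt dx n (U k) ->
      (forall j, U k.+1 j = scheme_step M gamma dt dx n (U k) j) ->
      forall j : int,
        eta M (U k.+1 j) - eta M (U k j)
        + dt / dx * (Q (U k j) (U k (j + 1)) - Q (U k (j - 1)) (U k j))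
        <= 0)) /\
  (forall um up, Omega um -> Omega up ->
     dotv (eta' M up - eta' M um) (h um up)
     <= dotv (psi M up - psi M um) n) /\
  (forall U : nat -> int -> state R m d,
     (forall k, CFL M gamma dt dx n (U k)) ->
     (forall k j, U k.+1 j = scheme_step M gamma dt dx n (U k) j) ->
     (forall j, Omega (U 0%N j)) ->
     forall k j, Omega (U k j)).
Proof.
move=> Omega h Q; have l0 : 0 < dt / dx by rewrite divr_gt0.
split; first by move=> u Ou; exact: num_flux_consistent.
split; first exact: num_flux_locally_lipschitz.
split; [split=> [u Ou|U k OU cfl step j]|split=> [um up Om Op|U cfl step O0]].
- exact: num_entropy_flux_consistent.
- have [_] := scheme_step_stable hCv hgam hgamma hn j l0 OU cfl.
  by rewrite -step /Q mulrBr [in X in _ -> X]mulrBr; lra.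
- exact: num_flux_Tadmor.
- elim=> // k IH j; rewrite step.
  by have [] := scheme_step_stable hCv hgam hgamma hn j l0 IH (cfl k).
Qed.
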